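(* The isometry class $\widehat{D2P}_{\mathcal{B}}=\{\mu\in\mathcal{B}: X_\mu$ has the diameter two property$\}$ is $G_\delta$-complete in $\mathcal{B}$.
   Context: $V$ is the set of finitely supported rational sequences; $\mathcal{P}\subset\mathbb{R}^V$ the seminorms on $V$ with pointwise convergence topology; for $\mu\in\mathcal{P}$, $\bar\mu$ is its seminorm extension to $c_{00}$ and $X_\mu$ the completion of $c_{00}/\{\bar\mu=0\}$; $\mathcal{B}$ is the set of $\mu\in\mathcal{P}$ with $X_\mu$ infinite-dimensional and $\bar\mu$ a norm on $c_{00}$, with the subspace topology (a Polish space). A Banach space $X$ has the diameter two property (D2P) if every nonempty relatively weakly open subset of $B_X$ has diameter 2. A subset $A$ of a Polish space $Z$ is $G_\delta$-complete if it is $G_\delta$ and for every zero-dimensional Polish space $Y$ and $G_\delta$ set $B\subset Y$ there is a continuous $f:Y\to Z$ with $B=f^{-1}(A)$. *)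

(* Defs.v *)
From HB Require Import structures.
From mathcomp Require Import all_boot all_order all_algebra.
From mathcomp Require Import all_classical all_reals all_analysis.
From mathcomp Require Import Rstruct Rstruct_topology.
Set Implicit Arguments. Unset Strict Implicit. Unset Printing Implicit Defensive.
Import Order.TTheory GRing.Theory Num.Theory.
Import numFieldNormedType.Exports.
Local Open Scope classical_set_scope.
Local Open Scope ring_scope.

Notation R := Rdefinitions.R.

Definition fsuppQ (v : nat -> rat) := exists N, forall n, (N <= n)%N -> v n = 0.
Definition V := {v : nat -> rat | fsuppQ v}.

Definition c00 (x : nat -> R) := exists N, forall n, (N <= n)%N -> x n = 0.

Definition is_seminorm (mu : V -> R) :=
  (forall u v w : V, (forall n, sval w n = sval u n + sval v n) ->
      mu w <= mu u + mu v) /\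
  (forall (q : rat) (u w : V), (forall n, sval w n = q * sval u n) ->
      mu w = `|ratr q| * mu u).

Notation RV := {ptws V -> R}.

Definition Pset : set RV := [set mu | is_seminorm mu].

Definition roundseq (k : nat) (x : nat -> R) : nat -> rat :=
  fun i => if (i < k)%N then
             ((Num.floor (k.+1%:R * x i))%:~R / k.+1%:R : rat) else 0.

Lemma roundseq_fsupp k x : fsuppQ (roundseq k x).
Proof. by exists k => n Hn; rewrite /roundseq ltnNge Hn. Qed.

Definition roundV (k : nat) (x : nat -> R) : V :=
  exist _ (roundseq k x) (roundseq_fsupp k x).

(* \bar mu : the (unique continuous) extension of mu to c00 *)
Definition barmu (mu : V -> R) (x : nat -> R) : R :=
  lim ((fun k => mu (roundV k x)) @ \oo).

(* X_mu = completion of c00/{barmu = 0} is infinite dimensional: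
   for every n there are n vectors of c00 linearly independent modulo
   the null space of barmu *)
Definition Xmu_infinite_dim (mu : V -> R) :=
  forall n : nat, exists x : 'I_n -> (nat -> R),
    (forall i, c00 (x i)) /\
    forall a : 'I_n -> R,
      barmu mu (fun k => \sum_(i < n) a i * x i k) = 0 -> forall i, a i = 0.

Definition barmu_norm (mu : V -> R) :=
  forall x, c00 x -> barmu mu x = 0 -> x = (fun _ => 0).

Definition Bset : set RV :=
  [set mu | Pset mu /\ Xmu_infinite_dim mu /\ barmu_norm mu].

Definition is_completion (mu : V -> R) (X : completeNormedModType R)
    (T : (nat -> R) -> X) :=
  (forall (a : R) x y, c00 x -> c00 y ->
      T (fun n => a * x n + y n) = a *: T x + T y) /\
  (forall x, c00 x -> `|T x| = barmu mu x) /\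
  dense (T @` c00).

Definition linear_functional (X : normedModType R) (f : X -> R) :=
  forall (a : R) (x y : X), f (a *: x + y) = a * f x + f y.

Definition weakly_open (X : normedModType R) (U : set X) :=
  forall x, U x -> exists (n : nat) (f : 'I_n -> X -> R) (e : R),
    0 < e /\ (forall i, linear_functional (f i) /\ continuous (f i)) /\
    [set y | forall i, `|f i y - f i x| < e] `<=` U.

Definition unit_ball (X : normedModType R) : set X := [set x | `|x| <= 1].

Definition diam (X : normedModType R) (W : set X) : \bar R :=
  ereal_sup [set r | exists x y, W x /\ W y /\ r = (`|x - y|)%:E].

Definition D2P (X : normedModType R) :=
  forall U : set X, weakly_open U -> U `&` @unit_ball X !=set0 ->
    diam (U `&` @unit_ball X) = 2%:E.

Definition D2Phat : set RV :=
  [set mu | Bset mu /\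
     forall (X : completeNormedModType R) (T : (nat -> R) -> X),
       is_completion mu T -> D2P X].

Definition separable_space (Y : topologicalType) :=
  exists D : set Y, countable D /\ dense D.

Definition completely_metrizable (Y : topologicalType) :=
  exists d : Y -> Y -> R,
    (forall x y, 0 <= d x y) /\ (forall x y, d x y = 0 <-> x = y) /\
    (forall x y, d x y = d y x) /\
    (forall x y z, d x z <= d x y + d y z) /\
    (forall A : set Y, open A <->
       (forall x, A x -> exists e : R, 0 < e /\ [set y | d x y < e] `<=` A)) /\
    (forall u : nat -> Y,
       (forall e : R, 0 < e -> exists N, forall m n, (N <= m)%N -> (N <= n)%N ->
          d (u m) (u n) < e) ->
       exists l : Y, u @ \oo --> l).

Definition polish (Y : topologicalType) :=
  separable_space Y /\ completely_metrizable Y.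

Definition zero_dim (Y : topologicalType) :=
  forall (x : Y) (U : set Y), open U -> U x ->
    exists W : set Y, clopen W /\ W x /\ W `<=` U.

Definition Gdelta_in (T : topologicalType) (Z A : set T) :=
  A `<=` Z /\
  exists U : nat -> set T, (forall n, open (U n)) /\
    A = Z `&` \bigcap_n U n.

Definition Gdelta_complete_in (T : topologicalType) (Z A : set T) :=
  Gdelta_in Z A /\
  forall (Y : topologicalType), polish Y -> zero_dim Y ->
    forall Bs : set Y, Gdelta_in setT Bs ->
      exists f : Y -> T, continuous f /\ (forall y, Z (f y)) /\
        Bs = f @^-1` A.

(* Main.v *)
(** The D2P of [X_mu] only involves [mu] and the additive functionals [F] on [V] with
    [|F| <= mu], which are the restrictions of the functionals of norm at most 1 on
    [X_mu]: for every [x] of norm less than 1 in [V], every finite family of such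
    functionals and every [e > 0] there are [y], [z] in [V] of norm less than 1 with
    [mu (y - z) > 2 - e] on which the functionals are [e]-close to their values at [x].
    For fixed data this condition is open in [mu], because functionals dominated by
    seminorms converging to [mu] cluster pointwise at a functional dominated by [mu];
    as [V] is countable, the class is G_delta.

    For the hardness, a set of integers cuts [nat] into consecutive intervals, and we take
    on [V] the maximum over these intervals of the l_1 norms. With infinitely many cuts a
    far away unit vector at the start of an interval can be added to and subtracted from
    [x], since bounded functionals are almost zero on it; with finitely many cuts the
    first coordinates of the intervals define a weakly open set of small diameter. Writing
    a G_delta set of a zero-dimensional Polish space as the intersection of a decreasing
    sequence of countable unions of clopen sets [W n m], and cutting at (the code of)
    [(n, m)] when [m] is the first index with [y] in [W n m], one gets infinitely many cuts
    exactly when [y] belongs to the set. *)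
From HB Require Import structures.
Require Import Defs.
From mathcomp Require Import all_boot all_order all_algebra.
From mathcomp Require Import all_classical all_reals all_analysis.
From mathcomp Require Import Rstruct Rstruct_topology.
From mathcomp Require Import ring lra zify.
Set Implicit Arguments. Unset Strict Implicit. Unset Printing Implicit Defensive.
Import Order.TTheory GRing.Theory Num.Theory.
Import numFieldNormedType.Exports.
Local Open Scope classical_set_scope.
Local Open Scope ring_scope.

(* The libraries give [R] a pseudometric but put its normed module structure on [R^o] only. *)
HB.instance Definition _ := NormedModule.copy R R^o.
HB.instance Definition _ := Complete.copy R R^o.

(** * Completion of a seminormed space *)

Section SeminormTheory.
Variables (K : realType) (E : lmodType K).

Record seminorm := Seminorm {
  seminorm_val :> E -> K;
  seminormD : forall x y, seminorm_val (x + y) <= seminorm_val x + seminorm_val y;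
  seminormZ : forall a x, seminorm_val (a *: x) = `|a| * seminorm_val x }.

Variable p : seminorm.

Lemma seminorm0 : p 0 = 0.
Proof. by rewrite -(scale0r 0) seminormZ normr0 mul0r. Qed.

Lemma seminormN x : p (- x) = p x.
Proof. by rewrite -scaleN1r seminormZ normrN1 mul1r. Qed.

Lemma seminorm_distC x y : p (x - y) = p (y - x).
Proof. by rewrite -seminormN opprB. Qed.

Lemma seminorm_ge0 x : 0 <= p x.
Proof. by have := seminormD p x (- x); rewrite subrr seminorm0 seminormN; lra. Qed.

Lemma seminorm_triangle z x y : p (x - y) <= p (x - z) + p (z - y).
Proof. by have := seminormD p (x - z) (z - y); rewrite addrA subrK. Qed.

Lemma seminorm_dist x y : `|p x - p y| <= p (x - y).
Proof.
have := seminormD p (x - y) y; have := seminormD p (y - x) x.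
by rewrite !subrK (seminorm_distC y x) ler_distl => h1 h2; apply/andP; split; lra.
Qed.

Definition cauchy_seq (u : nat -> E) := forall e : K, 0 < e ->
  exists N, forall m n, (N <= m)%N -> (N <= n)%N -> p (u m - u n) < e.

(** Equality in the completion, at the level of representing sequences. *)
Definition coeq (u v : nat -> E) := forall e : K, 0 < e ->
  exists N, forall n, (N <= n)%N -> p (u n - v n) < e.

Lemma coeq_refl u : coeq u u.
Proof. by move=> e e0; exists 0%N => n _; rewrite subrr seminorm0. Qed.

Lemma coeq_sym u v : coeq u v -> coeq v u.
Proof.
by move=> h e /h[N hN]; exists N => n /hN; rewrite seminorm_distC.
Qed.

Lemma coeq_trans v u w : coeq u v -> coeq v w -> coeq u w.
Proof.
move=> uv vw e e0; have e2 : 0 < e / 2 by lra.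
have [M hM] := uv _ e2; have [N hN] := vw _ e2.
exists (maxn M N) => n; rewrite geq_max => /andP[/hM h1 /hN h2].
by have := seminorm_triangle (v n) (u n) (w n); lra.
Qed.

Lemma coeqD u u' v v' : coeq u u' -> coeq v v' ->
  coeq (fun n => u n + v n) (fun n => u' n + v' n).
Proof.
move=> uv vw e e0; have e2 : 0 < e / 2 by lra.
have [M hM] := uv _ e2; have [N hN] := vw _ e2.
exists (maxn M N) => n; rewrite geq_max => /andP[/hM h1 /hN h2].
by have := seminormD p (u n - u' n) (v n - v' n); rewrite addrACA -opprD; lra.
Qed.

Lemma coeqZ a u v : coeq u v -> coeq (fun n => a *: u n) (fun n => a *: v n).
Proof.
move=> uv e e0; have a1 : 0 < `|a| + 1 by rewrite ltr_wpDl.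
have [N hN] := uv _ (divr_gt0 e0 a1).
exists N => n /hN; rewrite -scalerBr seminormZ ltr_pdivlMr// mulrC.
by have := seminorm_ge0 (u n - v n); lra.
Qed.

Lemma cauchy_cst x : cauchy_seq (fun=> x).
Proof. by move=> e e0; exists 0%N => *; rewrite subrr seminorm0. Qed.

Lemma cauchyD u v : cauchy_seq u -> cauchy_seq v ->
  cauchy_seq (fun n => u n + v n).
Proof.
move=> uv vw e e0; have e2 : 0 < e / 2 by lra.
have [M hM] := uv _ e2; have [N hN] := vw _ e2.
exists (maxn M N) => m n; rewrite !geq_max => /andP[m1 m2] /andP[n1 n2].
have := seminormD p (u m - u n) (v m - v n); rewrite addrACA -opprD.
by have := hM _ _ m1 n1; have := hN _ _ m2 n2; lra.
Qed.

Lemma cauchyZ a u : cauchy_seq u -> cauchy_seq (fun n => a *: u n).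
Proof.
move=> uv e e0; have a1 : 0 < `|a| + 1 by rewrite ltr_wpDl.
have [N hN] := uv _ (divr_gt0 e0 a1).
exists N => m n hm hn; have := hN _ _ hm hn.
rewrite -scalerBr seminormZ ltr_pdivlMr// mulrC.
by have := seminorm_ge0 (u m - u n); lra.
Qed.

Lemma cauchy_seminorm_cvg u : cauchy_seq u -> cvgn (fun n => p (u n)).
Proof.
move=> cu; apply/cauchy_cvgP/cauchy_ballP => e e0; near_simpl.
have [N hN] := cu _ e0.
exists ([set n | N <= n]%N, [set n | N <= n]%N); first by split; exists N.
move=> [m n] [/= hm hn]; rewrite /ball/=.
exact: le_lt_trans (seminorm_dist _ _) (hN _ _ hm hn).
Qed.

Lemma coeq_seminorm u v l : coeq u v -> (p (u n) @[n --> \oo] --> (l : K)) ->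
  (p (v n) @[n --> \oo] --> (l : K)).
Proof.
move=> uv /cvgrPdist_lt hl; apply/cvgrPdist_lt => e e0.
have e2 : 0 < e / 2 by lra.
have [N hN] := uv _ e2; near=> n.
have h1 : `|l - p (u n)| < e / 2 by near: n; exact: hl.
have h2 : p (u n - v n) < e / 2 by apply: hN; near: n; exists N.
have h3 := seminorm_dist (u n) (v n).
by have := ler_distD (p (u n)) l (p (v n)); lra.
Unshelve. all: by end_near. Qed.

(* A canonical element of the class of [u], so that equivalent sequences become equal. *)
Definition canon (u : nat -> E) : nat -> E :=
  xget (fun=> 0) [set v | cauchy_seq v /\ coeq u v].

Record completion := Completion {
  crep : nat -> E;
  crepP : cauchy_seq crep;
  crep_canon : canon crep = crep }.

Lemma canonP u : cauchy_seq u -> cauchy_seq (canon u) /\ coeq u (canon u).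
Proof.
by move=> cu; rewrite /canon; case: xgetP => [v _ //|/(_ u)[]]; split=> //; exact: coeq_refl.
Qed.

Lemma canon_eq u v : coeq u v -> canon u = canon v.
Proof.
move=> uv; rewrite /canon; congr xget; apply/seteqP; split=> w /= [cw h]; split=> //.
  exact: coeq_trans (coeq_sym uv) h.
exact: coeq_trans uv h.
Qed.

Lemma canonK u : cauchy_seq u -> canon (canon u) = canon u.
Proof. by move=> /canonP[_ /canon_eq]. Qed.

Definition tocompl u (cu : cauchy_seq u) : completion :=
  Completion (proj1 (canonP cu)) (canonK cu).

Lemma crep_tocompl u (cu : cauchy_seq u) : coeq (crep (tocompl cu)) u.
Proof. exact: coeq_sym (proj2 (canonP cu)). Qed.

Lemma completion_eq x y : coeq (crep x) (crep y) -> x = y.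
Proof.
case: x y => [u cu hu] [v cv hv] /= /canon_eq; rewrite hu hv => uv.
by subst v; congr Completion; exact: Prop_irrelevance.
Qed.

End SeminormTheory.

HB.instance Definition _ (K : realType) (E : lmodType K) (p : seminorm E) :=
  gen_eqMixin (completion p).
HB.instance Definition _ (K : realType) (E : lmodType K) (p : seminorm E) :=
  gen_choiceMixin (completion p).

(** * Normed module structure and completeness of the completion *)

Section CompletionModule.
Variables (K : realType) (E : lmodType K) (p : seminorm E).
Local Notation C := (completion p).
Implicit Types x y z : C.

Definition cembed (e : E) : C := tocompl (cauchy_cst p e).
Definition cadd x y : C := tocompl (cauchyD (crepP x) (crepP y)).
Definition cscale a x : C := tocompl (cauchyZ a (crepP x)).

Lemma crep_embed e : coeq p (crep (cembed e)) (fun=> e).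
Proof. exact: crep_tocompl. Qed.

Lemma crep_add x y : coeq p (crep (cadd x y)) (fun n => crep x n + crep y n).
Proof. exact: crep_tocompl. Qed.

Lemma crep_scale a x : coeq p (crep (cscale a x)) (fun n => a *: crep x n).
Proof. exact: crep_tocompl. Qed.

(** Every module axiom goes through this lemma: both sides are represented by explicit sequences in
    [E], which agree termwise by the same axiom in [E]. *)
Lemma completion_ext x y u v :
  coeq p (crep x) u -> coeq p (crep y) v -> u =1 v -> x = y.
Proof.
by move=> h1 /coeq_sym h2 /funext uv; subst v; apply/completion_eq/(coeq_trans h1).
Qed.

Lemma caddA : associative cadd.
Proof.
move=> x y z.
apply: (completion_ext (coeq_trans (crep_add _ _) (coeqD (coeq_refl _ _) (crep_add _ _)))
  (coeq_trans (crep_add _ _) (coeqD (crep_add _ _) (coeq_refl _ _)))) => n.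
exact: addrA.
Qed.

Lemma caddC : commutative cadd.
Proof.
by move=> x y; apply: (completion_ext (crep_add _ _) (crep_add _ _)) => n; exact: addrC.
Qed.

Lemma cadd0 : left_id (cembed 0) cadd.
Proof.
move=> x; apply: (completion_ext (coeq_trans (crep_add _ _)
  (coeqD (crep_embed _) (coeq_refl _ _))) (coeq_refl _ _)) => n.
exact: add0r.
Qed.

Lemma caddN : left_inverse (cembed 0) (cscale (-1)) cadd.
Proof.
move=> x; apply: (completion_ext (coeq_trans (crep_add _ _)
  (coeqD (crep_scale _ _) (coeq_refl _ _))) (crep_embed 0)) => n.
by rewrite scaleN1r addNr.
Qed.

HB.instance Definition _ := GRing.isZmodule.Build C caddA caddC cadd0 caddN.

Lemma cscaleA a b x : cscale a (cscale b x) = cscale (a * b) x.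
Proof.
apply: (completion_ext (coeq_trans (crep_scale _ _) (coeqZ _ (crep_scale _ _)))
  (crep_scale _ _)) => n.
exact: scalerA.
Qed.

Lemma cscale1 : left_id 1 cscale.
Proof.
by move=> x; apply: (completion_ext (crep_scale _ _) (coeq_refl _ _)) => n; exact: scale1r.
Qed.

Lemma cscaleDr : right_distributive cscale +%R.
Proof.
move=> a x y; apply: (completion_ext (coeq_trans (crep_scale _ _) (coeqZ a (crep_add _ _)))
  (coeq_trans (crep_add _ _) (coeqD (crep_scale _ _) (crep_scale _ _)))) => n.
exact: scalerDr.
Qed.

Lemma cscaleDl x : {morph cscale^~ x : a b / a + b}.
Proof.
move=> a b; apply: (completion_ext (crep_scale _ _)
  (coeq_trans (crep_add _ _) (coeqD (crep_scale _ _) (crep_scale _ _)))) => n.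
exact: scalerDl.
Qed.

HB.instance Definition _ :=
  GRing.Zmodule_isLmodule.Build K C cscaleA cscale1 cscaleDr cscaleDl.

Definition cnorm x : K := limn (fun n => p (crep x n)).

Lemma cnorm_cvg x u : coeq p (crep x) u -> p (u n) @[n --> \oo] --> cnorm x.
Proof.
by move=> /coeq_seminorm; apply; exact: cauchy_seminorm_cvg (crepP x).
Qed.

Lemma cnormD x y : cnorm (x + y) <= cnorm x + cnorm y.
Proof.
apply: (@ler_cvg_to _ _ _ _ _ _ _ _ (cnorm_cvg (crep_add x y))
  (cvgD (cnorm_cvg (coeq_refl p (crep x))) (cnorm_cvg (coeq_refl p (crep y))))).
by near=> n; exact: seminormD.
Unshelve. all: by end_near. Qed.

Lemma cnormZ a x : cnorm (a *: x) = `|a| * cnorm x.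
Proof.
have h1 := cnorm_cvg (crep_scale a x); have h2 := cnorm_cvg (coeq_refl p (crep x)).
apply: (cvg_unique _ h1); first exact: Rhausdorff.
rewrite (_ : (fun n => _) = (fun n => `|a| * p (crep x n))); first exact: cvgMl_tmp.
by apply/funext => n; exact: seminormZ.
Qed.

Lemma cnorm0_eq0 x : cnorm x = 0 -> x = 0.
Proof.
move=> x0; apply: (@completion_ext _ _ _ (fun=> 0) _ (crep_embed 0)) => // e e0.
have /cvgrPdist_lt/(_ _ e0)[N _ hN] := cnorm_cvg (coeq_refl p (crep x)).
exists N => n /hN /=; rewrite x0 sub0r normrN subr0 ger0_norm//.
exact: seminorm_ge0.
Qed.

HB.instance Definition _ :=
  @Lmodule_isNormed.Build K C cnorm cnormD cnormZ cnorm0_eq0.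

Lemma cembed_linear a e e' : cembed (a *: e + e') = a *: cembed e + cembed e'.
Proof.
apply: (completion_ext (crep_embed _) (coeq_trans (crep_add _ _)
  (coeqD (coeq_trans (crep_scale _ _) (coeqZ _ (crep_embed _))) (crep_embed _)))) => n //.
Qed.

Lemma cembedB e e' : cembed (e - e') = cembed e - cembed e'.
Proof. by rewrite -scaleN1r addrC cembed_linear scaleN1r addrC. Qed.

Lemma norm_cembed e : `|cembed e| = p e.
Proof.
by apply: (cvg_unique _ (cnorm_cvg (crep_embed e))); [exact: Rhausdorff|exact: cvg_cst].
Qed.

Lemma cembed_near x u : cauchy_seq p u -> coeq p (crep x) u ->
  forall e, 0 < e -> exists N, forall n, (N <= n)%N -> `|x - cembed (u n)| < e.
Proof.
move=> cu xu e e0; have e2 : 0 < e / 2 by lra.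
have [N hN] := cu _ e2.
exists N => n Nn; apply: (@le_lt_trans _ _ (e / 2)); last by lra.
(* For fixed [n], the difference is represented by the sequence [u m - u n] in [m], so its norm is a
   limit of reals that are eventually at most [e / 2]. *)
have h : coeq p (crep (x - cembed (u n))) (fun m => u m + (-1) *: u n).
  rewrite -(scaleN1r (cembed _)).
  apply: coeq_trans (crep_add _ _) (coeqD xu _).
  exact: coeq_trans (crep_scale _ _) (coeqZ _ (crep_embed _)).
rewrite -[leLHS]/(cnorm _); apply: (cvgr_to_le (cnorm_cvg h)).
by exists N => // m /= Nm; rewrite scaleN1r ltW// hN.
Qed.

Lemma cembed_dense x e : 0 < e -> exists v, `|x - cembed v| < e.
Proof.
move=> e0; have [N hN] := cembed_near (crepP x) (coeq_refl p _) e0.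
by exists (crep x N); exact: hN.
Qed.

(** [F] contains balls of radius [1 / (n + 1)] centred at embedded points [w n]. Two such balls
    meet, so [w] is a Cauchy sequence in [E], and its class is the limit of [F]. *)
Lemma completion_complete (F : set_system C) : ProperFilter F -> cauchy F -> cvg F.
Proof.
move=> FF /cauchyP Fc.
have step n : exists e : E, F (ball (cembed e) (n.+1%:R^-1)).
  have h : 0 < n.+1%:R^-1 / 2 :> K by rewrite divr_gt0.
  have [x Fx] := Fc _ h; have [v hv] := cembed_dense x h.
  exists v; apply: filterS Fx => y; rewrite -!ball_normE /ball_/= => xy.
  rewrite (le_lt_trans (ler_distD x _ _))// [_%:R^-1]splitr ltrD// distrC//.
have [w hw] := choice step.
have wc m n : p (w m - w n) < m.+1%:R^-1 + n.+1%:R^-1.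
  have [y []] := filter_ex (filterI (hw m) (hw n)).
  rewrite -!ball_normE /ball_/= => h1 h2.
  rewrite -norm_cembed cembedB (le_lt_trans (ler_distD y _ _))// ltrD// distrC//.
have cw : cauchy_seq p w.
  move=> e e0; have e2 : 0 < e / 2 by lra.
  have [N _ hN] := near_infty_natSinv_lt (PosNum e2).
  exists N => m n hm hn; apply: lt_trans (wc m n) _.
  by rewrite [e]splitr ltrD// hN.
apply/cvg_ex; exists (tocompl cw); apply/cvgrPdist_lt => e e0.
have e2 : 0 < e / 2 by lra.
have [N1 _ hN1] := near_infty_natSinv_lt (PosNum e2).
have [N2 hN2] := cembed_near cw (crep_tocompl cw) e2.
pose N := maxn N1 N2; apply: filterS (hw N) => y; rewrite -ball_normE /ball_/= => h.
rewrite (le_lt_trans (ler_distD (cembed (w N)) _ _))// [e]splitr ltrD//.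
  exact: hN2 (leq_maxr _ _).
exact: lt_trans h (hN1 _ (leq_maxl _ _)).
Qed.

HB.instance Definition _ := Uniform_isComplete.Build C completion_complete.

End CompletionModule.

(** * The extension of a seminorm from V to c00 *)

Lemma V_eq (u v : V) : (forall n, sval u n = sval v n) -> u = v.
Proof.
by case: u v => [u hu] [v hv] /= /funext uv; subst v; congr exist; exact: Prop_irrelevance.
Qed.

Lemma fsuppQ_add u v : fsuppQ u -> fsuppQ v -> fsuppQ (fun n => u n + v n).
Proof.
move=> [M hM] [N hN]; exists (maxn M N) => n.
by rewrite geq_max => /andP[/hM -> /hN ->]; rewrite addr0.
Qed.

Lemma fsuppQ_scale q u : fsuppQ u -> fsuppQ (fun n => q * u n).
Proof. by move=> [M hM]; exists M => n /hM ->; rewrite mulr0. Qed.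

Lemma fsuppQ_trunc N (u : nat -> rat) : fsuppQ (fun n => if (n < N)%N then u n else 0).
Proof. by exists N => n; rewrite leqNgt => /negbTE ->. Qed.

Definition vadd (u v : V) : V := exist _ _ (fsuppQ_add (svalP u) (svalP v)).
Definition vscale q (u : V) : V := exist _ _ (fsuppQ_scale q (svalP u)).
Definition vsub (u v : V) : V := vadd u (vscale (-1) v).
(** The sequence [u] is arbitrary, so this also serves to build elements of [V] from formulas. *)
Definition vtrunc N (u : nat -> rat) : V := exist _ _ (fsuppQ_trunc N u).
Definition vunit i : V := vtrunc i.+1 (fun n => (n == i)%:R).

Lemma vunitE i n : sval (vunit i) n = (n == i)%:R.
Proof. by rewrite /= ltnS; case: ltngtP. Qed.

Lemma vaddE u v n : sval (vadd u v) n = sval u n + sval v n. Proof. by []. Qed.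

Lemma vscaleE q u n : sval (vscale q u) n = q * sval u n. Proof. by []. Qed.

Lemma vtruncE N u n : sval (vtrunc N u) n = if (n < N)%N then u n else 0.
Proof. by []. Qed.

Lemma vsubE u v n : sval (vsub u v) n = sval u n - sval v n.
Proof. by rewrite /= mulN1r. Qed.

Definition vreal (v : V) : nat -> R := fun n => ratr (sval v n).

Lemma vrealD u v : vreal (vadd u v) = (fun n => vreal u n + vreal v n).
Proof. by apply/funext => n; rewrite /vreal rmorphD. Qed.

Lemma vrealZ q v : vreal (vscale q v) = (fun n => ratr q * vreal v n).
Proof. by apply/funext => n; rewrite /vreal rmorphM. Qed.

Lemma vrealB u v : vreal (vsub u v) = (fun n => vreal u n - vreal v n).
Proof. by apply/funext => n; rewrite /vreal vsubE rmorphB. Qed.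

Lemma vreal_unit i n : vreal (vunit i) n = (n == i)%:R.
Proof. by rewrite /vreal vunitE ratr_nat. Qed.

Lemma c00_vreal v : c00 (vreal v).
Proof. by case: (svalP v) => N hN; exists N => n /hN; rewrite /vreal => ->; rewrite rmorph0. Qed.

Lemma c00_lin a x y : c00 x -> c00 y -> c00 (fun n => a * x n + y n).
Proof.
move=> [M hM] [N hN]; exists (maxn M N) => n.
by rewrite geq_max => /andP[/hM -> /hN ->]; rewrite mulr0 addr0.
Qed.

Section Seminorm.
Variables (mu : V -> R).
Hypothesis muP : Pset mu.

Lemma muD u v : mu (vadd u v) <= mu u + mu v.
Proof. by apply: (proj1 muP). Qed.

Lemma muZ q u : mu (vscale q u) = `|ratr q| * mu u.
Proof. by apply: (proj2 muP). Qed.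

Lemma mu0 v : (forall n, sval v n = 0) -> mu v = 0.
Proof.
move=> h; have -> : v = vscale 0 v by apply: V_eq => n /=; rewrite h mul0r.
by rewrite muZ rmorph0 normr0 mul0r.
Qed.

Lemma mu_subC u v : mu (vsub u v) = mu (vsub v u).
Proof.
have -> : vsub u v = vscale (-1) (vsub v u).
  by apply: V_eq => n; rewrite /= !mulN1r opprD opprK addrC.
by rewrite muZ rmorphN1 normrN1 mul1r.
Qed.

Lemma mu_sub u v : mu (vsub u v) <= mu u + mu v.
Proof.
by apply: le_trans (muD _ _) _; rewrite muZ rmorphN1 normrN1 mul1r.
Qed.

Lemma mu_ge0 v : 0 <= mu v.
Proof.
have := mu_sub v v; rewrite (mu0 (v := vsub v v)); first by lra.
by move=> n; rewrite vsubE subrr.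
Qed.

Lemma mu_dist u v : `|mu u - mu v| <= mu (vsub u v).
Proof.
have := muD (vsub u v) v; have := muD (vsub v u) u.
have h a b : vadd (vsub a b) b = a by apply: V_eq => n; rewrite /= mulN1r subrK.
by rewrite !h (mu_subC v u) ler_distl => h1 h2; apply/andP; split; lra.
Qed.

(** Splitting off the last coordinate repeatedly bounds [mu] by a weighted l_1 norm; hence on
    vectors with a common support bound [mu] is continuous for coordinatewise convergence. *)
Lemma mu_coord_le N (u : V) : (forall n, (N <= n)%N -> sval u n = 0) ->
  mu u <= \sum_(i < N) `|vreal u i| * mu (vunit i).
Proof.
elim: N u => [|N IH] u hu; first by rewrite big_ord0 mu0// => n; exact: hu.
rewrite big_ord_recr /=.
have -> : u = vadd (vtrunc N (sval u)) (vscale (sval u N) (vunit N)).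
  apply: V_eq => n; rewrite vaddE vscaleE vtruncE vunitE.
  by case: ltngtP => [nN|Nn|->]; rewrite ?mulr0 ?addr0 ?mulr1 ?add0r// hu.
apply: le_trans (muD _ _) _; rewrite muZ; apply: lerD.
  apply: le_trans (IH _ _) _; first by move=> n; rewrite leqNgt vtruncE => /negbTE ->.
  apply: ler_sum => i _; rewrite /vreal vaddE vscaleE vtruncE vunitE ltn_ord.
  by rewrite ltn_eqF// mulr0 addr0.
by rewrite /vreal vaddE vscaleE vtruncE vunitE ltnn eqxx mulr1 add0r.
Qed.

Definition gap N (x : nat -> R) (u : V) : R :=
  \sum_(i < N) `|x i - vreal u i| * mu (vunit i).

Lemma gap_ge0 N x u : 0 <= gap N x u.
Proof. by apply: sumr_ge0 => i _; rewrite mulr_ge0// mu_ge0. Qed.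

Lemma mu_sub_gap N x u v :
  (forall n, (N <= n)%N -> sval u n = 0) -> (forall n, (N <= n)%N -> sval v n = 0) ->
  mu (vsub u v) <= gap N x u + gap N x v.
Proof.
move=> hu hv; apply: le_trans (mu_coord_le (N := N) _) _.
  by move=> n Nn; rewrite vsubE hu// hv// subr0.
rewrite -big_split /=; apply: ler_sum => i _; rewrite -mulrDl ler_wpM2r ?mu_ge0//.
by rewrite /vreal vsubE rmorphB /= (distrC (x i) (ratr (sval u i))) ler_distD.
Qed.

(** The support bound [N] is uniform in [k], which lets coordinatewise convergence control [mu]. *)
Definition approx N (x : nat -> R) (u : nat -> V) :=
  (forall k n, (N <= n)%N -> sval (u k) n = 0) /\
  forall i, vreal (u k) i @[k --> \oo] --> x i.

Lemma approx_gap N x u : approx N x u -> gap N x (u k) @[k --> \oo] --> (0 : R).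
Proof.
move=> [_ hu].
have -> : 0 = \sum_(i < N) (`|x i - x i| * mu (vunit i)) :> R.
  by rewrite big1// => i _; rewrite subrr normr0 mul0r.
apply: (cvg_big (@pseudometric_normed_Zmodule.add_continuous _ R)) => i _.
apply: cvgMr_tmp; apply: cvg_norm.
by apply: cvgB; [exact: cvg_cst|exact: hu].
Qed.

Lemma approx_gap_lt N x u e : approx N x u -> 0 < e ->
  exists K, forall k, (K <= k)%N -> gap N x (u k) < e.
Proof.
move=> /approx_gap/cvgrPdist_lt h /h[K _ hK]; exists K => k /hK /=.
by rewrite sub0r normrN ger0_norm// gap_ge0.
Qed.

Lemma approx_round N x : (forall n, (N <= n)%N -> x n = 0) -> approx N x (roundV^~ x).
Proof.
move=> hx; split=> [k n Nn|i].
  by rewrite /= /roundseq hx// mulr0 floor0 mul0r; case: ifP.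
apply/cvgrPdist_lt => e e0.
have [M _ hM] := near_infty_natSinv_lt (PosNum e0).
(* The [k]-th rounding is zero from coordinate [k] on, so [k] must also exceed [i]. *)
exists (maxn M i.+1) => // k /=; rewrite geq_max => /andP[/hM /= h ik].
apply: le_lt_trans h; rewrite /vreal /= /roundseq ik fmorph_div /= ratr_int ratr_nat.
have k0 : 0 < k.+1%:R :> R by [].
have /andP[h1 h2] := floor_itv (k.+1%:R * x i).
rewrite -[X in X - _](mulKf (lt0r_neq0 k0)) mulrC -mulrBl normrM [`|_^-1|]gtr0_norm ?invr_gt0//.
rewrite -[leRHS]mul1r ler_wpM2r// ?invr_ge0//.
rewrite ler_norml; move: h1 h2; rewrite intrD; lra.
Qed.

(** [barmu] can be computed along any approximating sequence, not only the roundings; this is how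
    the properties of [mu] pass to [barmu]. *)
Lemma approx_barmu N x u : approx N x u -> mu (u k) @[k --> \oo] --> barmu mu x.
Proof.
move=> hu; have [su cu] := hu.
have hx n : (N <= n)%N -> x n = 0.
  move=> Nn; apply: (cvg_unique _ (cu n)); first exact: Rhausdorff.
  by apply: cvg_near_cst; exists 0%N => // k _; rewrite /vreal su// rmorph0.
have hr := approx_round hx.
(* The roundings are [mu]-Cauchy, so the [lim] in [barmu] is a genuine limit. *)
have cr : cvgn (fun k => mu (roundV k x)).
  apply: cauchy_cvg; apply: cauchy_exP => e e0.
  have e2 : 0 < e / 2 by lra.
  have [K hK] := approx_gap_lt hr e2.
  exists (mu (roundV K x)); exists K => // k Kk; rewrite /ball/=.
  apply: le_lt_trans (mu_dist _ _) _.
  apply: le_lt_trans (mu_sub_gap x (proj1 hr K) (proj1 hr k)) _.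
  by have := hK K (leqnn K); have := hK k Kk; lra.
apply: cvg_sub0 cr => /=.
apply/cvgr0Pnorm_lt => e e0.
have e2 : 0 < e / 2 by lra.
have [K hK] := approx_gap_lt hr e2.
have [L hL] := approx_gap_lt hu e2.
exists (maxn K L) => // k /=; rewrite geq_max => /andP[/hK h1 /hL h2].
apply: le_lt_trans (mu_dist _ _) _.
by apply: le_lt_trans (mu_sub_gap x (su k) (proj1 hr k)) _; lra.
Qed.

Lemma c00_approx x : c00 x -> exists N, approx N x (roundV^~ x).
Proof. by move=> [N hN]; exists N; exact: approx_round. Qed.

Lemma approx_widen M N x u : (N <= M)%N -> approx N x u -> approx M x u.
Proof. by move=> NM [h1 h2]; split=> // k n Mn; apply: h1; exact: leq_trans Mn. Qed.

Lemma barmuD x y : c00 x -> c00 y ->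
  barmu mu (fun n => x n + y n) <= barmu mu x + barmu mu y.
Proof.
move=> /c00_approx[M hM] /c00_approx[N hN].
have {hM}hM := approx_widen (leq_maxl M N) hM; have {hN}hN := approx_widen (leq_maxr M N) hN.
have hs : approx (maxn M N) (fun n => x n + y n) (fun k => vadd (roundV k x) (roundV k y)).
  split=> [k n h|i]; first by rewrite vaddE (proj1 hM k n h) (proj1 hN k n h) addr0.
  rewrite (_ : (fun k => _) = (fun k => vreal (roundV k x) i + vreal (roundV k y) i)).
    exact: cvgD (proj2 hM i) (proj2 hN i).
  by apply/funext => k; rewrite /vreal rmorphD.
apply: (@ler_cvg_to _ _ _ _ _ _ _ _ (approx_barmu hs)
  (cvgD (approx_barmu hM) (approx_barmu hN))).
by near=> n; exact: muD.
Unshelve. all: by end_near. Qed.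

Lemma barmuZ a x : c00 x -> barmu mu (fun n => a * x n) = `|a| * barmu mu x.
Proof.
move=> /c00_approx[N hN].
(* [mu] is homogeneous for rational scalars only, so [a] is rounded too, as the coordinate 0 of a
   sequence. *)
pose q k : rat := sval (roundV k (fun=> a)) 0%N.
have [_ /(_ 0%N) hq] : approx 1 (fun n => if n == 0%N then a else 0)
    (roundV^~ (fun n => if n == 0%N then a else 0)) by apply: approx_round; case.
have {}hq : (ratr (q k) : R) @[k --> \oo] --> a by exact: hq.
have hs : approx N (fun n => a * x n) (fun k => vscale (q k) (roundV k x)).
  split=> [k n h|i]; first by rewrite vscaleE (proj1 hN k n h) mulr0.
  rewrite (_ : (fun k => _) = (fun k => ratr (q k) * vreal (roundV k x) i)).
    exact: cvgM hq (proj2 hN i).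
  by apply/funext => k; rewrite /vreal rmorphM.
apply: (cvg_unique _ (approx_barmu hs)); first exact: Rhausdorff.
rewrite (_ : (fun k => _) = (fun k => `|ratr (q k)| * mu (roundV k x))).
  exact: cvgM (cvg_norm hq) (approx_barmu hN).
by apply/funext => k; exact: muZ.
Qed.

Lemma barmu_vreal v : barmu mu (vreal v) = mu v.
Proof.
have [N hN] := svalP v.
have h : approx N (vreal v) (fun=> v) by split=> // i; exact: cvg_cst.
by apply: (cvg_unique _ (approx_barmu h)); [exact: Rhausdorff|exact: cvg_cst].
Qed.

Lemma barmu_dense x e : c00 x -> 0 < e ->
  exists v, barmu mu (fun n => x n - vreal v n) < e.
Proof.
move=> /c00_approx[N hN] e0.
have e3 : 0 < e / 3 by lra.
have [K hK] := approx_gap_lt hN e3.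
exists (roundV K x); apply: (@le_lt_trans _ _ (e / 3 + e / 3)); last by lra.
have hs : approx N (fun n => x n - vreal (roundV K x) n)
    (fun k => vsub (roundV k x) (roundV K x)).
  split=> [k n h|i]; first by rewrite vsubE (proj1 hN k n h) (proj1 hN K n h) subr0.
  rewrite (_ : (fun k => _) = (fun k => vreal (roundV k x) i - vreal (roundV K x) i)).
    exact: cvgB (proj2 hN i) (cvg_cst _).
  by apply/funext => k; rewrite /vreal vsubE rmorphB.
apply: (cvgr_to_le (approx_barmu hs)); exists K => // k Kk.
apply: le_trans (mu_sub_gap x (proj1 hN k) (proj1 hN K)) _.
by rewrite lerD// ltW// hK.
Qed.

Lemma c00_coef (q : {poly R}) : c00 (fun n => q`_n).
Proof. by exists (size q) => n hn; rewrite nth_default. Qed.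

Lemma barmu_polyD (q r : {poly R}) : barmu mu (fun n => (q + r)`_n) <=
  barmu mu (fun n => q`_n) + barmu mu (fun n => r`_n).
Proof.
by have := barmuD (c00_coef q) (c00_coef r); under eq_fun do rewrite -coefD.
Qed.

Lemma barmu_polyZ a (q : {poly R}) : barmu mu (fun n => (a *: q)`_n) =
  `|a| * barmu mu (fun n => q`_n).
Proof.
by rewrite -(barmuZ a (c00_coef q)); congr barmu; apply/funext => n; rewrite coefZ.
Qed.

(* [{poly R}] serves as the vector space [c00]. *)
Definition poly_seminorm : seminorm {poly R} := Seminorm barmu_polyD barmu_polyZ.

Definition c00_poly (x : nat -> R) : {poly R} := xget 0 [set q : {poly R} | forall n, q`_n = x n].

Lemma coef_c00_poly x n : c00 x -> (c00_poly x)`_n = x n.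
Proof.
move=> [N hN]; rewrite /c00_poly; case: xgetP => [q _ /(_ n) //|/(_ (\poly_(i < N) x i))[]] k.
by rewrite coef_poly; case: ltnP => // /hN.
Qed.

(** [D2Phat] quantifies over all completions, so one must exist for membership to carry any
    information. *)
Lemma completion_exists : exists (X : completeNormedModType R) T, @is_completion mu X T.
Proof.
exists (completion poly_seminorm), (fun x => cembed poly_seminorm (c00_poly x)).
split; [|split].
- move=> a x y cx cy; rewrite -cembed_linear; congr cembed; apply/polyP => n.
  by rewrite coefD coefZ !coef_c00_poly//; exact: c00_lin.
- move=> x cx; rewrite norm_cembed /=; congr barmu.
  by apply/funext => n; rewrite coef_c00_poly.
- move=> U [x Ux] oU.
  have /nbhs_ballP[e /= e0 hU] := open_nbhs_nbhs (conj oU Ux).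
  have [q hq] := cembed_dense x e0; exists (cembed poly_seminorm q); split.
    by apply: hU; rewrite -ball_normE.
  exists (fun n => q`_n); first exact: c00_coef.
  by congr cembed; apply/polyP => n; rewrite coef_c00_poly//; exact: c00_coef.
Qed.

End Seminorm.

(** * The diameter two property in terms of mu *)

Lemma natSinv_lt (k : nat) (e : R) : 0 < e ->
  exists n, (k <= n)%N /\ (n.+1%:R^-1 < e :> R).
Proof.
move=> e0; have [N _ hN] := near_infty_natSinv_lt (PosNum e0).
by exists (maxn N k); split; [exact: leq_maxr|exact: hN (leq_maxl _ _)].
Qed.

Lemma rat_near (a e : R) : 0 < e -> exists q : rat, `|a - ratr q| < e.
Proof.
move=> e0; have h : a - e < a + e by lra.
have [q] := rat_in_itvoo h; rewrite in_itv /= => hq.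
by exists q; rewrite distrC ltr_distl.
Qed.

Definition qfun (mu F : V -> R) :=
  (forall u v, F (vadd u v) = F u + F v) /\
  (forall q u, F (vscale q u) = ratr q * F u) /\
  (forall u, `|F u| <= mu u).

(** The index [n] gives both the number of constrained functionals and the tolerance. The first
    alternative disposes of [x] unless its norm is at most [1 - 1 / (n + 1)]. All inequalities in
    the alternatives are strict, so their failure survives limits of [mu] and [F]. *)
Definition d2cond (mu : V -> R) (x : V) (n : nat) :=
  forall F : nat -> V -> R, (forall i, qfun mu (F i)) ->
  1 - n.+1%:R^-1 < mu x \/
  exists y z, [/\ mu y < 1, mu z < 1, 2 - n.+1%:R^-1 < mu (vsub y z) &
    forall i, (i < n)%N -> `|F i y - F i x| < n.+1%:R^-1 /\
                           `|F i z - F i x| < n.+1%:R^-1].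

Lemma qfunB mu F u v : qfun mu F -> F (vsub u v) = F u - F v.
Proof. by move=> [h1 [h2 _]]; rewrite h1 h2 rmorphN1 mulN1r. Qed.

Lemma qfun_trunc mu F L (s : nat -> rat) : qfun mu F ->
  F (vtrunc L s) = \sum_(i < L) ratr (s i) * F (vunit i).
Proof.
move=> [FD [FZ _]]; elim: L => [|L IH].
  have -> : vtrunc 0 s = vscale 0 (vunit 0) by apply: V_eq => n; rewrite vscaleE mul0r.
  by rewrite FZ rmorph0 mul0r big_ord0.
rewrite big_ord_recr /= -IH -FZ -FD; congr F; apply: V_eq => n.
rewrite vaddE vscaleE vunitE !vtruncE ltnS.
by case: ltngtP => [||->]; rewrite ?mulr0 ?addr0 ?mulr1 ?add0r.
Qed.

(** * Bounded functionals and their extension to the completion *)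

Section Functionals.
Variable X : normedModType R.

Lemma linear_functional0 (f : X -> R) : linear_functional f -> f 0 = 0.
Proof. by move=> fl; have := fl 1 0 0; rewrite scaler0 addr0; lra. Qed.

Lemma linear_functionalZ (f : X -> R) a x : linear_functional f -> f (a *: x) = a * f x.
Proof. by move=> fl; have := fl a x 0; rewrite addr0 (linear_functional0 fl) addr0. Qed.

Lemma linear_functionalB (f : X -> R) x y : linear_functional f -> f (x - y) = f x - f y.
Proof. by move=> fl; rewrite addrC -scaleN1r fl mulN1r addrC. Qed.

Lemma linear_functional_bound (f : X -> R) : linear_functional f -> continuous f ->
  exists M, 0 < M /\ forall x, `|f x| <= M * `|x|.
Proof.
move=> fl /(_ 0); rewrite /continuous_at (linear_functional0 fl).
move=> /cvgr0Pnorm_lt/(_ _ ltr01)/nbhs_ballP[d /= d0 hd].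
exists (2 / d); split=> [|x]; first by rewrite divr_gt0.
have [->|x0] := eqVneq x 0; first by rewrite (linear_functional0 fl) !normr0 mulr0.
have nx : 0 < `|x| by rewrite normr_gt0.
have c0 : 0 < d / 2 / `|x| by rewrite !divr_gt0.
have := hd ((d / 2 / `|x|) *: x); rewrite -ball_normE /ball_/= sub0r normrN normrZ.
rewrite linear_functionalZ// [`|_ * f x|]normrM (gtr0_norm c0) divfK ?gt_eqF//.
have -> : d / 2 < d by lra.
move=> /(_ isT) /ltW; rewrite -ler_pdivlMl// => /le_trans; apply.
by rewrite mulr1 !invf_div mulrC.
Qed.

End Functionals.

Section Completion.
Variables (mu : V -> R) (X : completeNormedModType R) (T : (nat -> R) -> X).
Hypotheses (muP : Pset mu) (muT : is_completion mu T).

Let J v := T (vreal v).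

Let JD u v : J (vadd u v) = J u + J v.
Proof.
have [h _] := muT; rewrite -[J u]scale1r -h; try exact: c00_vreal.
by congr T; apply/funext => n; rewrite /vreal mul1r rmorphD.
Qed.

Let TZ a x : c00 x -> T (fun n => a * x n) = a *: T x.
Proof.
have [h _] := muT => cx; have c0 : c00 (fun=> 0) by exists 0%N.
have T0 : T (fun=> 0) = 0.
  have := h 1 _ _ c0 c0; rewrite scale1r.
  have -> : (fun n : nat => 1 * 0 + 0 : R) = (fun=> 0).
    by apply/funext => n; rewrite mulr0 addr0.
  by move/eqP; rewrite -subr_eq0 opprD addrA subrr sub0r oppr_eq0 => /eqP.
rewrite -[RHS]addr0 -T0 -h//; congr T; apply/funext => n.
by rewrite addr0.
Qed.

Let JZ q u : J (vscale q u) = ratr q *: J u.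
Proof.
rewrite -TZ; last exact: c00_vreal.
by congr T; apply/funext => n; rewrite /vreal rmorphM.
Qed.

Let JB u v : J (vsub u v) = J u - J v.
Proof. by rewrite JD JZ rmorphN1 scaleN1r. Qed.

Let normJ v : `|J v| = mu v.
Proof. by have [_ [h _]] := muT; rewrite h ?barmu_vreal//; exact: c00_vreal. Qed.

Let J_dense x e : 0 < e -> exists v, `|x - J v| < e.
Proof.
move=> e0; have e2 : 0 < e / 2 by lra.
have [h [hn hd]] := muT.
have [t [hx [w cw wt]]] := hd _ (ex_intro _ x (ballxx x e2)) (ball_open x (e / 2)).
have [v hv] := barmu_dense muP cw e2; exists v.
have {hx wt} : ball x (e / 2) (T w) by rewrite wt.
rewrite -ball_normE /ball_/= => hx.
apply: le_lt_trans (ler_distD (T w) _ _) _; rewrite [e]splitr ltrD//.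
have <- : T (fun n => w n - vreal v n) = T w - J v.
  rewrite addrC -scaleN1r -h//; last exact: c00_vreal.
  by congr T; apply/funext => n; rewrite mulN1r addrC.
rewrite hn// (_ : (fun n => _) = (fun n => -1 * vreal v n + w n)).
  by apply: c00_lin => //; exact: c00_vreal.
by apply/funext => n; rewrite mulN1r addrC.
Qed.

Let J_dense_ball x e : `|x| <= 1 -> 0 < e -> exists v, mu v < 1 /\ `|x - J v| < e.
Proof.
(* Shrinking [x] by [1 - d] before approximating it within [d] keeps the approximant strictly inside
   the ball, at a total error of at most [2 * d < e]. *)
move=> x1 e0; pose d := Num.min (e / 3) (1 / 2).
have [d0 de d1] : [/\ 0 < d, d <= e / 3 & d <= 1 / 2].
  by split; rewrite ?lt_min ?ge_min ?lexx ?orbT//; apply/andP; split; lra.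
have [v hv] := J_dense ((1 - d) *: x) d0; exists v.
have hx : `|(1 - d) *: x| <= 1 - d.
  by rewrite normrZ ger0_norm; [rewrite ler_piMr//; lra|lra].
split.
  rewrite -normJ; have := ler_distD ((1 - d) *: x) 0 (J v).
  by rewrite !sub0r !normrN; lra.
apply: le_lt_trans (ler_distD ((1 - d) *: x) _ _) _.
have -> : x - (1 - d) *: x = d *: x by rewrite scalerBl scale1r opprB addrC subrK.
rewrite normrZ gtr0_norm//.
have : d * `|x| <= d by rewrite ler_piMr// ltW.
by lra.
Qed.

(* McShane's formula extends [F] to a point [x]; being 1-Lipschitz along the dense
   range of [J] determines the value, so the extension is linear. *)
Let qfun_point F x : qfun mu F -> exists y, forall v, `|y - F v| <= `|x - J v|.
Proof.
move=> hF; pose A := [set r | exists v, r = F v - `|x - J v|].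
have hA v w : F v - `|x - J v| <= F w + `|x - J w|.
  have := proj2 (proj2 hF) (vsub v w); rewrite (qfunB _ _ hF) -normJ JB ler_norml => /andP[_].
  by have := ler_distD x (J v) (J w); rewrite (distrC (J v) x); lra.
have A0 : A !=set0 by exists (F (vunit 0) - `|x - J (vunit 0)|), (vunit 0).
exists (sup A) => v; rewrite ler_distl; apply/andP; split.
  apply: ub_le_sup; last by exists v.
  by exists (F v + `|x - J v|) => _ [w ->].
by apply: ge_sup => // _ [w ->].
Qed.

Lemma qfun_extend F : qfun mu F -> exists f : X -> R,
  [/\ linear_functional f, continuous f, forall x, `|f x| <= `|x| &
      forall v, f (J v) = F v].
Proof.
move=> hF; have [f hf] := choice (fun x => qfun_point x hF).
have fJ v : f (J v) = F v.
  by apply/eqP; have := hf (J v) v; rewrite subrr normr0 normr_le0 subr_eq0.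
have fl : linear_functional f.
  move=> a x y; apply/eqP; rewrite -subr_eq0 -normr_le0; apply/ler_addgt0Pl => e e0.
  rewrite addr0.
  have a0 : 0 < `|a| + 1 by rewrite ltr_wpDl.
  (* [x], [y] and [a] are replaced by [v], [w] and [q], for which [F] is linear. There are three
     errors for [f (a *: x + y)] and three for [a * f x + f y], hence the sixths; [q] comes last
     because its precision depends on [mu v]. *)
  have [v hv] := J_dense x (divr_gt0 e0 (mulr_gt0 (ltr0n _ 6) a0 : 0 < 6%:R * _)).
  have [w hw] := J_dense y (divr_gt0 e0 (ltr0n _ 6)).
  have v0 : 0 < mu v + 1 by rewrite ltr_wpDl// mu_ge0.
  have [q hq] := rat_near a (divr_gt0 e0 (mulr_gt0 (ltr0n _ 6) v0 : 0 < 6%:R * _)).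
  have {}hv : `|a| * `|x - J v| < e / 6.
    move: hv; rewrite invfM mulrA ltr_pdivlMr// mulrC mulrDl mul1r.
    by have := normr_ge0 (x - J v); lra.
  have {}hq : `|a - ratr q| * mu v < e / 6.
    move: hq; rewrite invfM mulrA ltr_pdivlMr// mulrDr mulr1.
    by have := normr_ge0 (a - ratr q); lra.
  have h1 : `|(a *: x + y) - J (vadd (vscale q v) w)| <= e / 6 + e / 6 + e / 6.
    rewrite JD JZ.
    have -> : a *: x + y - (ratr q *: J v + J w) =
        a *: (x - J v) + (a - ratr q) *: J v + (y - J w).
      by rewrite scalerBr scalerBl [a *: x - _ + _]addrA subrK opprD addrACA.
    apply: le_trans (ler_normD _ _) _; apply: lerD; last exact: ltW.
    apply: le_trans (ler_normD _ _) _; apply: lerD; rewrite normrZ ?normJ; exact: ltW.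
  have h2 := le_trans (hf _ _) h1.
  have h3 : `|a * f x - ratr q * F v| <= e / 6 + e / 6.
    have -> : a * f x - ratr q * F v = a * (f x - F v) + (a - ratr q) * F v by ring.
    apply: le_trans (ler_normD _ _) _; rewrite !normrM; apply: lerD.
      by apply: le_trans (ltW hv); rewrite ler_wpM2l.
    by apply: le_trans (ltW hq); rewrite ler_wpM2l// (proj2 (proj2 hF)).
  have h4 := le_trans (hf y w) (ltW hw).
  move: h2 h3 h4; rewrite (proj1 hF) (proj1 (proj2 hF)).
  set A := f (_ + _); set B := a * f x; set D := ratr q * F v => h2 h3 h4.
  have -> : A - (B + f y) = (A - (D + F w)) - (B - D) - (f y - F w) by ring.
  apply: le_trans (ler_normB _ _) _; have := ler_normB (A - (D + F w)) (B - D).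
  by lra.
have f1 x : `|f x| <= `|x|.
  have := hf x (vscale 0 (vunit 0)).
  by rewrite JZ (proj1 (proj2 hF)) rmorph0 mul0r scale0r !subr0.
exists f; split=> // x; apply/cvgrPdist_lt => e e0.
near=> y; rewrite -linear_functionalB//; apply: le_lt_trans (f1 _) _.
by near: y; exact: cvgr_dist_lt.
Unshelve. all: by end_near. Qed.

Lemma D2P_d2cond x n : D2P X -> d2cond mu x n.
Proof.
move=> hX F hF; set e : R := n.+1%:R^-1.
have e0 : 0 < e by rewrite invr_gt0.
have [hx|hx] := ltP (1 - e) (mu x); [by left|right].
have [f hf] := choice (fun i => qfun_extend (hF i)).
pose W u (d : R) := [set w | forall i : 'I_n, `|f i w - f i u| < d].
(* The interior of the box [W (J x) (e / 2)]: it is weakly open by the triangle inequality, with no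
   minimum over the functionals to compute. *)
pose U := [set u | exists2 d : R, 0 < d & W u d `<=` W (J x) (e / 2)].
have oU : weakly_open U.
  move=> u [d d0 hd]; exists n, (fun i : 'I_n => f i), (d / 2); split; first by lra.
  split=> [i|y /= hy]; first by have [] := hf i.
  exists (d / 2); first by lra.
  apply: subset_trans hd => w hw i.
  by have := ler_distD (f i y) (f i w) (f i u); have := hy i; have := hw i; lra.
have UJ : (U `&` @unit_ball X) (J x).
  split; last by rewrite /unit_ball /= normJ; lra.
  by exists (e / 2) => //; lra.
have := hX U oU (ex_intro _ _ UJ).
(* Moving both points into the range of [J] costs [e / 4] each, which leaves a distance above
   [2 - 3 * e / 4]; the functionals stay within [e / 2 + e / 4]. *)
move=> hd; have : ((2 - e / 4)%:E < diam (U `&` @unit_ball X))%E by rewrite hd lte_fin; lra.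
move=> /ereal_sup_gt[_ [y' [z' [[[dy dy0 Uy] By] [[[dz dz0 Uz] Bz] ->]]]]].
rewrite lte_fin => hyz.
have e4 : 0 < e / 4 by lra.
have hd' w d : 0 < d -> W w d `<=` W (J x) (e / 2) -> forall i, (i < n)%N ->
    `|f i w - f i (J x)| < e / 2.
  move=> d0 h i ni; apply: (h w _ (Ordinal ni)) => j.
  by rewrite subrr normr0.
have [y [y1 yy]] := J_dense_ball By e4; have [z [z1 zz]] := J_dense_ball Bz e4.
have near_le i a b : `|a - J b| < e / 4 -> `|f i a - f i (J x)| < e / 2 ->
    `|F i b - F i x| < e.
  have [fl _ f1 fJ] := hf i => h1; rewrite -!fJ.
  have := f1 (a - J b); rewrite linear_functionalB//.
  by have := ler_distD (f i a) (f i (J b)) (f i (J x)); rewrite (distrC (f i (J b)) (f i a)); lra.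
have hy := hd' _ _ dy0 Uy; have hz := hd' _ _ dz0 Uz.
exists y, z; split=> //.
  rewrite -normJ JB; have := ler_distD (J y) y' z'; have := ler_distD (J z) (J y) z'.
  by rewrite (distrC (J z)); lra.
by move=> i ni; split; [exact: near_le yy (hy i ni)|exact: near_le zz (hz i ni)].
Qed.

Lemma d2cond_D2P : (forall x n, d2cond mu x n) -> D2P X.
Proof.
move=> hmu U oU [u [Uu Bu]]; have [k [f [e [e0 [hf hU]]]]] := oU u Uu.
have [M hM] := choice (fun i => linear_functional_bound (proj1 (hf i)) (proj2 (hf i))).
(* Dividing by [S] makes all the functionals contractive at once; the summand 1 keeps [S] positive
   when [k = 0]. *)
pose S := 1 + \sum_(i < k) M i.
have MS i : M i <= S.
  rewrite /S (bigD1 i)//= addrCA lerDl addr_ge0// sumr_ge0// => j _.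
  by have [/ltW] := hM j.
have S0 : 0 < S.
  by rewrite ltr_wpDr// sumr_ge0// => j _; have [/ltW] := hM j.
(* The family is padded by zero functionals beyond [k]. *)
pose F i v := if insub i is Some j then f (j : 'I_k) (J v) / S else 0.
have hF i : qfun mu (F i).
  rewrite /F; case: insubP => [j _ _|_]; last first.
    by split; [|split] => *; rewrite ?addr0 ?mulr0 ?normr0// mu_ge0.
  have [fl _] := hf j; split; [|split] => *.
  - by rewrite JD -[X in f j (X + _)]scale1r fl mul1r mulrDl.
  - by rewrite JZ linear_functionalZ// mulrA.
  - rewrite normrM [`|S^-1|]gtr0_norm ?invr_gt0// ler_pdivrMr// -normJ mulrC.
    have [_ h] := hM j; apply: le_trans (h _) _; exact: ler_wpM2r.
apply/eqP; rewrite eq_le; apply/andP; split.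
  apply: ge_ereal_sup => _ [y [z [[_ hy] [[_ hz] ->]]]].
  rewrite lee_fin; apply: le_trans (ler_normB _ _) _.
  by move: hy hz; rewrite /unit_ball /=; lra.
apply/lee_addgt0Pr => d d0.
have eS : 0 < e / 2 / S by rewrite !divr_gt0.
have [x [x1 hx]] := J_dense_ball Bu eS.
(* The three bounds serve the diameter, the rescaled functionals, and the exclusion of the first
   alternative of [d2cond]. Taking [n] at least [k] constrains all the given functionals. *)
pose m : R := Num.min d (Num.min (e / 2 / S) (1 - mu x)).
have m0 : 0 < m by rewrite !lt_min d0 eS; lra.
have [n [kn]] := natSinv_lt k m0; rewrite !lt_min => /and3P[nd ne nx].
have {}nd : n.+1%:R^-1 < d :> R by exact: nd.
have [h|[y [z [y1 z1 yz hyz]]]] := hmu x n F hF.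
  by move: h; rewrite ltrBlDr -ltrBlDl ltNge (ltW nx).
have inU v : (forall i, (i < n)%N -> `|F i v - F i x| < n.+1%:R^-1) -> U (J v).
  move=> h; apply: hU => i /=.
  have := h i (leq_trans (ltn_ord i) kn); rewrite /F valK.
  rewrite -mulrBl normrM [`|S^-1|]gtr0_norm ?invr_gt0// => h1.
  have {h1} : `|f i (J v) - f i (J x)| / S < e / 2 / S by exact: lt_trans h1 ne.
  rewrite ltr_pM2r ?invr_gt0// => h1.
  have [fl _] := hf i; have [_ /(_ (u - J x))] := hM i.
  rewrite linear_functionalB// => h2.
  have h3 : M i * `|u - J x| <= S * `|u - J x| by rewrite ler_wpM2r.
  have h4 : S * `|u - J x| < e / 2 by rewrite mulrC -ltr_pdivlMr.
  by have := ler_distD (f i (J x)) (f i (J v)) (f i u); rewrite (distrC (f i (J x)) (f i u)); lra.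
have inD v : mu v < 1 -> U (J v) -> (U `&` @unit_ball X) (J v).
  by move=> v1 Uv; split=> //; rewrite /unit_ball /= normJ ltW.
apply: (@le_trans _ _ ((mu (vsub y z))%:E + d%:E)%E).
  by rewrite -EFinD lee_fin -lerBlDr; apply: le_trans (ltW yz); rewrite lerD2l lerN2 ltW.
apply: leeD2r; apply: ereal_sup_ubound; exists (J y), (J z).
split; first by apply: inD => //; apply: inU => i /hyz[].
split; first by apply: inD => //; apply: inU => i /hyz[].
by rewrite -JB normJ.
Qed.

End Completion.

(** * The class is G_delta *)

Lemma eval_continuous (v : V) : continuous (fun mu : RV => mu v).
Proof.
move=> mu; have /cvg_sup/(_ v)/cvg_image h : mu --> mu by exact: cvg_id.
apply: cvg_trans (h _) => [A [/= W hW <-]|]; last first.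
  by rewrite eqEsubset; split=> r // _; exists (fun=> r).
by apply: filterS hW; exact: preimage_image.
Qed.

Lemma continuous_RV (Y : topologicalType) (f : Y -> RV) :
  (forall v, continuous (fun y => f y v)) -> continuous f.
Proof.
move=> hf y; apply/cvg_sup => v; rewrite cvg_image; last first.
  by rewrite eqEsubset; split=> r // _; exists (fun=> r).
move=> A /(hf v y) h; exists (@^~ v @^-1` A); first exact: h.
by rewrite eqEsubset; split=> [_ [g /= ? <-]//|r Ar]; exists (fun=> r).
Qed.

Lemma ultra_fmap (S S' : Type) (f : S -> S') (F : set_system S) :
  UltraFilter F -> UltraFilter (f @ F).
Proof.
move=> FU; split=> [|G PG sub]; first exact: fmap_proper_filter.
apply/predeqP => A; split=> [GA|/sub //].
have [//|FnA] := in_ultra_setVsetC (f @^-1` A) FU.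
have /sub GnA : (f @ F) (~` A) by exact: FnA.
by have [x []] := filter_ex (filterI GA GnA).
Qed.

Lemma ultra_bounded_cvg (S : Type) (f : S -> R) (F : set_system S) M :
  UltraFilter F -> (\forall x \near F, `|f x| <= M) -> cvg (f x @[x --> F]).
Proof.
move=> FU hM; have := @segment_compact _ (- M) M; rewrite compact_ultra.
have fU := ultra_fmap f FU; case/(_ _ fU); last by move=> l [_ fl]; apply/cvg_ex; exists l.
by apply: filterS hM => x /=; rewrite in_itv /= -ler_norml.
Qed.

Definition bad x n : set RV := [set mu | Pset mu /\ ~ d2cond mu x n].

(* Functionals witnessing the failure of [d2cond] for seminorms converging to [mu]
   are bounded at each vector, so they converge along an ultrafilter, and the limits
   witness the failure for [mu]. *)
Lemma closure_bad x n (mu : RV) : Pset mu -> closure (bad x n) mu -> ~ d2cond mu x n.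
Proof.
move=> muP hcl hmu.
(* [U] refines the trace on the bad set of the neighbourhoods of [mu]. *)
have [U [UU hU]] := ultraFilterLemma (within_nbhs_proper hcl).
have Umu (v : V) : nu v @[nu --> U] --> mu v.
  move=> A hA; apply: hU; have h := @eval_continuous v mu A hA.
  by apply: (@filterS _ (nbhs mu) _ _ _ _ h) => nu Anu _; exact: Anu.
have Ubad : U (bad x n) by apply: hU; apply: nearW.
pose wit (nu : RV) (F : nat -> V -> R) := (forall i, qfun nu (F i)) /\
  ~ (1 - n.+1%:R^-1 < nu x \/
  exists y z, [/\ nu y < 1, nu z < 1, 2 - n.+1%:R^-1 < nu (vsub y z) &
    forall i, (i < n)%N -> `|F i y - F i x| < n.+1%:R^-1 /\
                           `|F i z - F i x| < n.+1%:R^-1]).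
have /choice[F hF] : forall nu : RV, exists F : nat -> V -> R, bad x n nu -> wit nu F.
  move=> nu.
  have [[_ /existsNP[F /not_implyP[h1 h2]]]|h] := pselect (bad x n nu).
    by exists F.
  by exists (fun _ _ => 0).
have Uwit : \forall nu \near U, wit nu (F nu) by apply: filterS Ubad => nu /hF.
have hcv i v : cvg (F nu i v @[nu --> U]).
  apply: (ultra_bounded_cvg (M := mu v + 1)) => //; near=> nu.
  have [/(_ i)[_ [_ /(_ v) h1]] _] : wit nu (F nu) by near: nu.
  apply: le_trans h1 _; apply/ltW; near: nu.
  by apply: (cvgr_lt _ (Umu v) (mu v + 1)); rewrite ltrDl.
pose G i v := lim (F nu i v @[nu --> U]).
have hG i v : F nu i v @[nu --> U] --> G i v by exact: hcv.
have Gq i : qfun mu (G i).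
  split; [move=> u v|split=> [q u|u]].
  - apply: (cvg_unique _ (hG i _)); first exact: Rhausdorff.
    apply: cvg_trans (cvgD (hG i u) (hG i v)); apply: near_eq_cvg; near=> nu.
    by have [/(_ i)[h _] _] : wit nu (F nu) by near: nu.
  - apply: (cvg_unique _ (hG i _)); first exact: Rhausdorff.
    have h : ratr q * F nu i u @[nu --> U] --> (ratr q * G i u : R).
      by apply: cvgM; [exact: cvg_cst|exact: hG].
    apply: cvg_trans h; apply: near_eq_cvg; near=> nu.
    by have [/(_ i)[_ [h _]] _] : wit nu (F nu) by near: nu.
  - apply: (ler_cvg_to (cvg_norm (hG i u)) (Umu u)); near=> nu.
    by have [/(_ i)[_ [_ h]] _] : wit nu (F nu) by near: nu.
(* Whichever alternative holds for [mu] and [G], it consists of finitely many strict inequalities,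
   so it holds for [nu] and [F nu] along [U], against [wit]. *)
have [hx|[y [z [y1 z1 yz hyz]]]] := hmu G Gq.
  suff : \forall nu \near U, False by move=> /filter_ex[].
  near=> nu; have [_ h] : wit nu (F nu) by near: nu.
  by apply: h; left; near: nu; exact: (cvgr_gt _ (Umu x) _ hx).
suff : \forall nu \near U, False by move=> /filter_ex[].
have hi i v : (i < n)%N -> `|G i v - G i x| < n.+1%:R^-1 ->
    \forall nu \near U, `|F nu i v - F nu i x| < n.+1%:R^-1.
  by move=> _ h; exact: (cvgr_lt _ (cvg_norm (cvgB (hG i v) (hG i x))) _ h).
have hall : \forall nu \near U, forall i : 'I_n,
    `|F nu i y - F nu i x| < n.+1%:R^-1 /\ `|F nu i z - F nu i x| < n.+1%:R^-1.
  apply: filter_forall => i; have [h1 h2] := hyz i (ltn_ord i).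
  by apply: filterI; apply: hi.
near=> nu; have [_ h] : wit nu (F nu) by near: nu.
apply: h; right; exists y, z; split.
- by near: nu; exact: (cvgr_lt _ (Umu y) _ y1).
- by near: nu; exact: (cvgr_lt _ (Umu z) _ z1).
- by near: nu; exact: (cvgr_gt _ (Umu (vsub y z)) _ yz).
- move=> i ni; suff h : forall j : 'I_n, `|F nu j y - F nu j x| < n.+1%:R^-1 /\
    `|F nu j z - F nu j x| < n.+1%:R^-1 by exact: (h (Ordinal ni)).
  by near: nu.
Unshelve. all: by end_near. Qed.

Lemma V_enum : exists e : nat -> V, forall v, exists n, e n = v.
Proof.
pose f (s : seq rat) : V := vtrunc (size s) (nth 0 s).
exists (fun n => f (odflt [::] (unpickle n))) => v; have [N hN] := svalP v.
exists (pickle (mkseq (sval v) N)); rewrite pickleK /=.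
apply: V_eq => n; rewrite vtruncE size_mkseq.
by case: ltnP => [nN|/hN ->//]; rewrite nth_mkseq.
Qed.

(** Among seminorms each bad set is closed by [closure_bad], so removing the closures of the
    countably many bad sets removes exactly the failures of [d2cond]. *)
Lemma Gdelta_D2Phat : Gdelta_in Bset D2Phat.
Proof.
split=> [mu []//|]; have [e he] := V_enum.
(* An integer coding no pair is read as [(0, 0)], which only repeats a set. *)
pose O k := ~` closure (bad (e (odflt (0, 0) (unpickle k : option (nat * nat))).1)
                            (odflt (0, 0) (unpickle k : option (nat * nat))).2).
exists O; split=> [k|]; first by apply: closed_openC; exact: closed_closure.
apply/seteqP; split=> mu.
  move=> [muB hD]; split=> // k _; have muP := proj1 muB.
  move=> /(closure_bad muP); apply.
  have [X [T muT]] := completion_exists muP.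
  exact: D2P_d2cond muP muT _ _ (hD X T muT).
move=> [muB hO]; split=> // X T muT; have muP := proj1 muB.
apply: (d2cond_D2P muP muT) => x n; have [m <-] := he x.
apply: contrapT => h; apply: (hO (pickle (m, n)) I); rewrite pickleK /=.
by apply: subset_closure; exact: (conj muP h).
Qed.

(** * Norms defined by a set of cuts *)

Section BlockNorm.
Variable a : nat -> bool.
Implicit Types (x y : nat -> R) (u v w : V).

(* [run x k] is the l_1 norm of [x] on the part up to [k] of the interval containing [k];
   an interval starts at 0 and at each [k] with [a k]. *)
Fixpoint run x k : R :=
  if k is k'.+1 then (if a k then 0 else run x k') + `|x k| else `|x 0%N|.

Fixpoint peak x k : R :=
  if k is k'.+1 then Num.max (peak x k') (run x k) else run x 0.

(** [run] increases along each interval, so its maximum is the largest l_1 norm of an interval. By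
    [run_tail] it does not grow past the support, so the chosen support bound does not matter. *)
Definition blocknorm v : R := peak (vreal v) (projT1 (cid (svalP v))).

Lemma run_ge0 x k : 0 <= run x k.
Proof. by elim: k => //= k IH; case: ifP => _; rewrite addr_ge0. Qed.

Lemma run_coord x k : `|x k| <= run x k.
Proof. by case: k => //= k; case: ifP => _; rewrite ?add0r// lerDr run_ge0. Qed.

Lemma runD x y k : run (fun n => x n + y n) k <= run x k + run y k.
Proof.
elim: k => [|k IH] /=; first exact: ler_normD.
have h := ler_normD (x k.+1) (y k.+1).
by case: ifP => _; move: h IH; lra.
Qed.

Lemma runZ c x k : run (fun n => c * x n) k = `|c| * run x k.
Proof.
elim: k => [|k IH] /=; first exact: normrM.
by rewrite IH normrM mulrDr; case: ifP => _; rewrite ?mulr0.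
Qed.

Lemma eq_run x y k : (forall j, (j <= k)%N -> x j = y j) -> run x k = run y k.
Proof.
elim: k => [|k IH] h /=; first by rewrite h.
by rewrite h// IH// => j jk; apply: h; exact: leqW.
Qed.

Lemma peak_ler x k K : (k <= K)%N -> run x k <= peak x K.
Proof.
elim: K => [|K IH] /=; first by rewrite leqn0 => /eqP ->.
by rewrite leq_eqVlt le_max => /orP[/eqP ->|/IH ->]; rewrite ?lexx ?orbT.
Qed.

Lemma peak_le x K c : (forall k, run x k <= c) -> peak x K <= c.
Proof.
move=> h; elim: K => [|K IH]; rewrite /= ?ge_max ?IH; first exact: (h 0%N).
exact: (h K.+1).
Qed.

Lemma run_tail x N k : (forall n, (N < n)%N -> x n = 0) -> (N <= k)%N ->
  run x k <= run x N.
Proof.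
move=> hx; elim: k => [|k IH]; first by rewrite leqn0 => /eqP ->.
rewrite leq_eqVlt => /orP[/eqP <-//|Nk] /=; rewrite hx// normr0 addr0.
by case: ifP => _; [exact: run_ge0|exact: IH].
Qed.

Lemma run_blocknorm v k : run (vreal v) k <= blocknorm v.
Proof.
rewrite /blocknorm; case: cid => N /= hN; have [kN|/ltnW Nk] := leqP k N.
  exact: peak_ler.
apply: le_trans (run_tail _ Nk) (peak_ler _ (leqnn N)) => n /ltnW /hN.
by rewrite /vreal => ->; rewrite rmorph0.
Qed.

Lemma blocknorm_le v c : (forall k, run (vreal v) k <= c) -> blocknorm v <= c.
Proof. exact: peak_le. Qed.

Lemma coord_blocknorm v k : `|vreal v k| <= blocknorm v.
Proof. exact: le_trans (run_coord _ _) (run_blocknorm _ _). Qed.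

Lemma Pset_blocknorm : Pset blocknorm.
Proof.
split=> [u v w hw|q u w hw].
  have -> : w = vadd u v by apply: V_eq.
  apply: blocknorm_le => k; rewrite vrealD; apply: le_trans (runD _ _ _) _.
  by apply: lerD; exact: run_blocknorm.
have -> : w = vscale q u by apply: V_eq.
have le p v : blocknorm (vscale p v) <= `|ratr p| * blocknorm v.
  by apply: blocknorm_le => k; rewrite vrealZ runZ ler_wpM2l// run_blocknorm.
apply/eqP; rewrite eq_le le /=; have [->|q0] := eqVneq q 0.
  rewrite rmorph0 normr0 mul0r; apply: le_trans (coord_blocknorm _ 0).
  exact: normr_ge0.
have n0 : 0 < `|ratr q : R| by rewrite normr_gt0 fmorph_eq0.
(* The reverse inequality is [le] for the inverse scalar. *)
rewrite -ler_pdivlMl// -normfV -fmorphV; apply: le_trans (le _ _).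
by rewrite (_ : vscale q^-1 _ = u)//; apply: V_eq => n; rewrite !vscaleE mulKf.
Qed.

(** The coordinates are dominated by the norm and hence by its extension, which is thus a norm on
    [c00]; the unit vectors then give infinite dimension. *)
Lemma Bset_blocknorm : Bset blocknorm.
Proof.
have hn : barmu_norm blocknorm.
  move=> x cx x0; apply/funext => i; apply/eqP; rewrite -normr_le0 -x0.
  have [N hN] := c00_approx cx.
  apply: (ler_cvg_to (cvg_norm (proj2 hN i)) (approx_barmu Pset_blocknorm hN)).
  by near=> k; exact: coord_blocknorm.
split; [exact: Pset_blocknorm|split=> // n].
exists (fun (i : 'I_n) (k : nat) => (k == i :> nat)%:R); split=> [i|b hb i].
  by exists n => k nk; case: eqP nk => // ->; rewrite leqNgt ltn_ord.
pose x (k : nat) : R := \sum_(j < n) b j * (k == j :> nat)%:R.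
have cx : c00 x.
  exists n => k nk; rewrite /x big1// => j _.
  by case: eqP nk => [->|]; rewrite ?mulr0// leqNgt ltn_ord.
have := congr1 (fun f => f (i : nat)) (hn x cx hb); rewrite /x (bigD1 i)//= eqxx mulr1.
rewrite big1 ?addr0// => j ji.
by rewrite (_ : (_ == _) = false) ?mulr0//; apply/negbTE; rewrite eq_sym.
Unshelve. all: by end_near. Qed.

(** The cut at [N] starts a new interval on which only the added vector lives. *)
Lemma blocknorm_bump (x : V) N q : a N -> (0 < N)%N ->
  (forall n, (N <= n)%N -> sval x n = 0) ->
  blocknorm (vadd x (vscale q (vunit N))) <= Num.max (blocknorm x) `|ratr q|.
Proof.
move=> aN N0 hx; set w := vadd _ _.
have wE n : vreal w n = vreal x n + (n == N)%:R * ratr q.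
  by rewrite vrealD vrealZ vreal_unit mulrC.
apply: blocknorm_le => k; have [Nk|kN] := leqP N k; rewrite le_max.
  apply/orP; right; apply: (@le_trans _ _ (run (vreal w) N)).
    apply: run_tail => // n Nn; rewrite wE gtn_eqF// mul0r addr0.
    by rewrite /vreal hx ?rmorph0// ltnW.
  case: N aN N0 hx @w wE Nk => // M aM _ hx w wE _ /=.
  by rewrite aM wE eqxx mul1r /vreal hx// rmorph0 !add0r.
rewrite (@eq_run _ (vreal x)) ?run_blocknorm// => j jk.
by rewrite wE ltn_eqF ?mul0r ?addr0// (leq_ltn_trans jk).
Qed.

(** [F] is tested on the vector of its signs at the cuts, whose norm is at most 1 because an
    interval contains at most one cut. *)
Lemma qfun_cut_sum F L : qfun blocknorm F -> \sum_(i < L | a i) `|F (vunit i)| <= 1.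
Proof.
move=> hF; pose s i : rat := if a i then (if 0 <= F (vunit i) then 1 else -1) else 0.
have -> : \sum_(i < L | a i) `|F (vunit i)| = F (vtrunc L s).
  rewrite (qfun_trunc _ _ hF) big_mkcond; apply: eq_bigr => i _ /=; rewrite /s.
  case: ifP => _; last by rewrite rmorph0 mul0r.
  case: lerP => [h|h]; first by rewrite rmorph1 mul1r ger0_norm.
  by rewrite rmorphN1 mulN1r ltr0_norm.
apply: le_trans (ler_norm _) (le_trans (proj2 (proj2 hF) _) _).
apply: blocknorm_le; set w := vreal _.
have hw n : `|w n| <= (a n)%:R.
  rewrite /w /vreal vtruncE /s; case: ifP => _; last by rewrite rmorph0 normr0.
  by case: (a n); [case: ifP; rewrite ?rmorphN1 ?rmorph1 ?normrN1 ?normr1|rewrite rmorph0 normr0].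
elim=> [|k IH] /=; first by apply: le_trans (hw _) _; case: (a _).
have := hw k.+1; case: (a _) => /=; first by rewrite add0r.
by move=> h; move: IH; lra.
Qed.

Lemma cut_count N K : (forall m, exists2 k, (m <= k)%N & a k) ->
  exists L, (K%:R : R) <= \sum_(i < L | a i && (N <= i)%N) 1.
Proof.
move=> ha; elim: K => [|K [L hL]]; first by exists 0%N; rewrite big_ord0.
have [k Lk ak] := ha (maxn L N); move: Lk; rewrite geq_max => /andP[Lk Nk].
exists k.+1; rewrite big_mkcond big_ord_recr /= -big_mkcond ak Nk /=.
rewrite -natr1 lerD2r; apply: le_trans hL _.
rewrite (big_ord_widen_cond k (fun i => a i && (N <= i)%N) (fun=> 1))//.
rewrite big_mkcond [leRHS]big_mkcond; apply: ler_sum => i _ /=.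
by case: (a i) => //=; case: leqP => //= _; case: ltnP.
Qed.

Lemma d2cond_blocknorm : (forall m, exists2 k, (m <= k)%N & a k) ->
  forall (x : V) n, d2cond blocknorm x n.
Proof.
move=> ha x n F hF; set e : R := n.+1%:R^-1.
have e0 : 0 < e by rewrite invr_gt0.
have e1 : e <= 1 by rewrite invf_le1// ler1n.
have [|xe] := ltP (1 - e) (blocknorm x); [by left|right].
have [N0 hN0] := svalP x.
(* Otherwise each cut beyond [N0] contributes at least [e] to the sum of all [|F i|] with [i < n],
   which is at most [n] in total; [(n + 1) ^ 2] such cuts would give [n + 1 <= n]. *)
have [N [N0N aN FN]] : exists N, [/\ (N0 < N)%N, a N & forall i, (i < n)%N -> `|F i (vunit N)| < e].
  apply: contrapT => hno.
  have hbig m : (N0 < m)%N -> a m -> e <= \sum_(i < n) `|F i (vunit m)|.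
    move=> N0m am; rewrite leNgt; apply/negP => h; apply: hno; exists m; split=> // i ni.
    apply: le_lt_trans h; rewrite (bigD1 (Ordinal ni))//= lerDl.
    by apply: sumr_ge0 => j _; exact: normr_ge0.
  have [L hL] := cut_count N0.+1 (n.+1 * n.+1) ha.
  have h1 : \sum_(m < L | a m && (N0 < m)%N) e <= n%:R.
    apply: (@le_trans _ _ (\sum_(m < L | a m && (N0 < m)%N) \sum_(i < n) `|F i (vunit m)|)).
      by apply: ler_sum => m /andP[am N0m]; exact: hbig.
    rewrite exchange_big /=; apply: (@le_trans _ _ (\sum_(i < n) 1)); last first.
      by rewrite sumr_const card_ord.
    apply: ler_sum => i _; apply: le_trans (qfun_cut_sum L (hF i)).
    rewrite big_mkcond [leRHS]big_mkcond; apply: ler_sum => m _.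
    by case: (a m) => //=; case: ifP => // _; exact: normr_ge0.
  have h2 : \sum_(m < L | a m && (N0 < m)%N) e = e * \sum_(m < L | a m && (N0 < m)%N) 1.
    by rewrite mulr_sumr; apply: eq_bigr => m _; rewrite mulr1.
  have h3 : e * (n.+1 * n.+1)%:R <= n%:R.
    by apply: le_trans h1; rewrite h2 ler_wpM2l// ltW.
  by move: h3; rewrite natrM mulrA mulVf// mul1r ler_nat ltnn.
(* The bumps have size below 1 and differ by [2 * q = 2 - e / 2] at coordinate [N]. *)
pose q : rat := 1 - n.+1%:R^-1 / 4.
have qE : ratr q = 1 - e / 4 :> R by rewrite rmorphB rmorph1 fmorph_div fmorphV /= !ratr_nat.
have x0 k : (N <= k)%N -> sval x k = 0 by move=> Nk; apply: hN0; exact: leq_trans (ltnW N0N) Nk.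
have N_gt0 : (0 < N)%N by exact: leq_ltn_trans N0N.
have nq : `|ratr q : R| = 1 - e / 4 by rewrite qE ger0_norm//; lra.
exists (vadd x (vscale q (vunit N))), (vadd x (vscale (- q) (vunit N))); split.
- apply: le_lt_trans (blocknorm_bump q aN N_gt0 x0) _.
  by rewrite nq gt_max; apply/andP; split; lra.
- apply: le_lt_trans (blocknorm_bump (- q) aN N_gt0 x0) _.
  by rewrite rmorphN normrN nq gt_max; apply/andP; split; lra.
- apply: lt_le_trans (coord_blocknorm _ N).
  rewrite vrealB !vrealD !vrealZ vreal_unit eqxx /= rmorphN qE !mulr1.
  by apply: lt_le_trans (ler_norm _); lra.
- move=> i ni; have [FD [FZ _]] := hF i; rewrite !FD !FZ rmorphN.
  rewrite [_ + _ - _]addrC addKr [_ + _ - _]addrC addKr mulNr normrN.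
  suff h : `|ratr q * F i (vunit N)| < e by [].
  rewrite normrM nq; apply: le_lt_trans (FN i ni).
  by rewrite ler_piMl//; lra.
Qed.

Lemma vreal_qfun j : qfun blocknorm (fun v => vreal v j).
Proof.
split; [|split] => *; rewrite ?vrealD ?vrealZ//; exact: coord_blocknorm.
Qed.

Fixpoint block_start k : nat := if k is k'.+1 then (if a k then k else block_start k') else 0%N.

Lemma block_start_cut k : (block_start k == 0)%N || a (block_start k).
Proof. by elim: k => //= k IH; case: ifP => //= ->. Qed.

(** Only the first coordinate of the interval is treated exactly: it adds [|y s - z s|] where
    [run y k + run z k] counts [y s + z s]. *)
Lemma run_diff y z k : (forall j, (j == 0)%N || a j -> 0 <= y j /\ 0 <= z j) ->
  let s := block_start k in
  run (fun n => y n - z n) k <= run y k + run z k - y s - z s + `|y s - z s|.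
Proof.
move=> h; elim: k => [|k IH] /=.
  by have [y0 z0] := h 0%N isT; rewrite (ger0_norm y0) (ger0_norm z0); lra.
case: ifP => ak.
  have [|y0 z0] := h k.+1; first by rewrite ak orbT.
  by rewrite (ger0_norm y0) (ger0_norm z0); lra.
by have := ler_normB (y k.+1) (z k.+1); move: IH => /=; lra.
Qed.

(** Let [x] be [1 - e] at the start of each interval. If [y] and [z] in the unit ball are close to
    [x] there, these coordinates nearly exhaust their norms on each interval, so [y - z] is
    small. *)
Lemma not_d2cond_blocknorm K : (forall k, (K <= k)%N -> ~~ a k) ->
  exists (x : V) n, ~ d2cond blocknorm x n.
Proof.
(* All interval starts are at most [K < n], so their coordinate functionals are constrained; and
   [e <= 1 / 7] gives [6 * e < 2 - e]. *)
move=> ha; pose n := (K + 6)%N; pose e : R := n.+1%:R^-1.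
pose st j := (j == 0)%N || a j.
have e0 : 0 < e by rewrite invr_gt0.
have e7 : e <= 7%:R^-1 by rewrite lef_pV2 ?posrE// ler_nat /n; lia.
have stn j : st j -> (j <= K)%N.
  by case/orP => [/eqP -> //|aj]; rewrite leqNgt; apply/negP => /ltnW/ha; rewrite aj.
pose c : rat := 1 - n.+1%:R^-1.
have cE : ratr c = 1 - e by rewrite rmorphB rmorph1 fmorphV /= ratr_nat.
pose x := vtrunc K.+1 (fun j => if st j then c else 0).
have xE j : vreal x j = if st j then 1 - e else 0.
  rewrite /vreal vtruncE ltnS; case: ifP => [_|jK]; first by case: ifP; rewrite ?cE ?rmorph0.
  by case: ifP => [/stn|]; rewrite ?jK// rmorph0.
exists x, n => hd.
have [||[y [z [y1 z1 yz hyz]]]] := hd (fun j v => if st j then vreal v j else 0).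
- move=> j; case: (st j); first exact: vreal_qfun.
  by split; [|split] => *; rewrite ?addr0 ?mulr0// normr0; apply: le_trans (coord_blocknorm _ 0).
- apply/negP; rewrite -leNgt; apply: blocknorm_le; elim=> [|k IH] /=; rewrite xE.
    by rewrite /st /= ger0_norm//; lra.
  rewrite /st /=; case: (a k.+1); last by rewrite normr0 addr0.
  by rewrite add0r ger0_norm//; lra.
have hst j : st j -> `|vreal y j - (1 - e)| < e /\ `|vreal z j - (1 - e)| < e.
  move=> sj; have := hyz j; rewrite sj xE sj; apply; rewrite /n.
  by have := stn _ sj; lia.
(* Both runs are below 1 and both starting values exceed [1 - 2 * e], leaving [4 * e], plus [2 * e]
   for their difference. *)
have : blocknorm (vsub y z) <= 6 * e.
  apply: blocknorm_le => k; rewrite vrealB.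
  have hpos j : st j -> 0 <= vreal y j /\ 0 <= vreal z j.
    by move=> /hst; rewrite !ltr_norml => -[/andP[? ?] /andP[? ?]]; split; lra.
  apply: le_trans (run_diff k hpos) _; set s := block_start k.
  have [] := hst s (block_start_cut k).
  have := run_blocknorm y k; have := run_blocknorm z k.
  rewrite !ltr_norml => h1 h2 /andP[h3 h4] /andP[h5 h6].
  have : `|vreal y s - vreal z s| <= 2 * e by rewrite ler_norml; apply/andP; split; lra.
  by lra.
move: yz; rewrite -/e; lra.
Qed.

End BlockNorm.

Lemma eq_run_cut a b x k : (forall j, (j <= k)%N -> a j = b j) -> run a x k = run b x k.
Proof.
elim: k => [//|k IH] h /=; rewrite h// IH// => j jk; apply: h; exact: leqW.
Qed.

Lemma eq_peak_cut a b x k : (forall j, (j <= k)%N -> a j = b j) -> peak a x k = peak b x k.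
Proof.
elim: k => [|k IH] h; first exact: eq_run_cut.
rewrite /peak -/(peak a x k) -/(peak b x k) (eq_run_cut _ h) IH// => j jk.
by apply: h; exact: leqW.
Qed.

(** At a fixed [v] only the cuts up to a support bound matter, so the value is locally constant in
    [y]. *)
Lemma blocknorm_cut_continuous (Y : topologicalType) (a : Y -> nat -> bool) :
  (forall k y, \forall y' \near y, a y' k = a y k) ->
  continuous ((fun y => blocknorm (a y)) : Y -> RV).
Proof.
move=> ha; apply: continuous_RV => v y; apply: cvg_near_cst.
rewrite /blocknorm; case: cid => N _ /=.
have : \forall y' \near y, forall j : 'I_N.+1, a y' j = a y j.
  by apply: filter_forall => j; exact: ha.
apply: filterS => y' h; apply: eq_peak_cut => j jN.
exact: (h (Ordinal (jN : (j < N.+1)%N))).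
Qed.

(** * Reduction of G_delta sets *)

Lemma open_bigcup_clopen (Y : topologicalType) (U : set Y) :
  polish Y -> zero_dim Y -> open U ->
  exists W : nat -> set Y, (forall m, clopen (W m)) /\ U = \bigcup_m W m.
Proof.
move=> [[D [/countable_injP[f finj] Dd]] [d [d0 [dE [dC [dT [dO _]]]]]]] Yzero oU.
have oball x e : open [set y | d x y < e].
  apply/dO => y /= xy; exists (e - d x y); split=> [|z /= yz]; first by lra.
  by have := dT x y z; lra.
(* [p] codes a ball by the number of its centre in [D] and its radius; one clopen subset of [U]
   containing this ball is selected, when there is one. *)
pose good (p : nat * nat) (W : set Y) := [/\ clopen W, W `<=` U &
  exists x, [/\ D x, f x = p.1 & [set y | d x y < p.2.+1%:R^-1] `<=` W]].
pose W p := xget set0 (good p).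
exists (fun m => if pickle_inv m is Some p then W p else set0); split=> [m|].
  case: pickle_inv => [p|]; last exact: (conj open0 closed0).
  by rewrite /W; case: xgetP => [? _ []//|_]; exact: (conj open0 closed0).
apply/seteqP; split=> [y Uy|y [m _]]; last first.
  case: pickle_inv => // p; rewrite /W; case: xgetP => [A _ [_ AU _]|//].
  exact: AU.
have [A [Acl [Ay AU]]] := Yzero y U oU Uy.
have [e [e0 he]] := (proj1 (dO A)) (proj1 Acl) y Ay.
have e2 : 0 < e / 2 by lra.
have [j [_ je]] := natSinv_lt 0 e2.
have yy : d y y < j.+1%:R^-1 by rewrite (proj2 (dE y y) erefl) invr_gt0.
have [x [/= yx Dx]] := Dd _ (ex_intro _ y yy) (oball y j.+1%:R^-1).
(* The selected set [B] may differ from [A], but it contains the ball around [x] and hence [y]; [A]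
   only shows that a choice exists. *)
exists (pickle (f x, j)) => //; rewrite pickleK_inv /W; case: xgetP => [B _|/(_ A)].
  move=> [_ _ [x' [Dx' fx' ]]]; have -> : x' = x by apply: finj => //; exact/mem_set.
  by apply; rewrite /= dC.
case; split=> //; exists x; split=> // z /= xz; apply: he => /=.
have := lt_trans yx je; have := lt_trans xz je; have := dT y x z; lra.
Qed.

(** * Cuts read off a double sequence of clopen sets *)

Section Cuts.
Variables (Y : topologicalType) (W : nat -> nat -> set Y).
Hypothesis Wcl : forall n m, clopen (W n m).

Definition first_hit y n m := W n m y /\ forall j, (j < m)%N -> ~ W n j y.

(** [pickle_inv] rejects the integers that are not codes, so a pair yields at most one cut. *)
Definition cuts y k : bool :=
  if pickle_inv k is Some p then `[< first_hit y p.1 p.2 >] else false.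

Lemma cuts_near k y : \forall y' \near y, cuts y' k = cuts y k.
Proof.
rewrite /cuts; case: pickle_inv => [[n m]|]; last exact: nearW.
have hW j : \forall y' \near y, W n j y' <-> W n j y.
  have [oW cW] := Wcl n j; have [h|h] := pselect (W n j y).
    by have := open_nbhs_nbhs (conj oW h); apply: filterS => y' h'; split.
  have := open_nbhs_nbhs (conj (closed_openC cW) h).
  by apply: filterS => y' h'; split=> // /h'.
have : \forall y' \near y, forall j : 'I_m.+1, W n j y' <-> W n j y.
  by apply: filter_forall => j; exact: hW.
apply: filterS => y' h /=; have {}h j : (j <= m)%N -> W n j y' <-> W n j y.
  by move=> jm; exact: (h (Ordinal (jm : (j < m.+1)%N))).
apply: asbool_equiv_eq; rewrite /first_hit; split=> -[h1 h2]; split.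
- exact/(h m).
- by move=> j jm /(h j (ltnW jm)); exact: h2.
- exact/(h m).
- by move=> j jm /(h j (ltnW jm)); exact: h2.
Qed.

Lemma cuts_infinite y : (forall n, (\bigcup_m W n m) y) ->
  forall M, exists2 k, (M <= k)%N & cuts y k.
Proof.
move=> hy M.
have /choice[m hm] : forall n, exists m, first_hit y n m.
  move=> n; have [m0 _ h0] := hy n.
  have ex : exists m, `[< W n m y >] by exists m0; exact/asboolP.
  case: (ex_minnP ex) => m /asboolP h1 h2; exists m; split=> // j jm /asboolP/h2.
  by rewrite leqNgt jm.
apply: contrapT => hno.
have hlt n : (pickle (n, m n) < M)%N.
  rewrite ltnNge; apply/negP => h; apply: hno; exists (pickle (n, m n)) => //.
  by rewrite /cuts pickleK_inv; exact/asboolP.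
(* Pigeonhole: the pairs [(n, m n)] have distinct codes, which cannot all lie below [M]. *)
have inj : injective (fun i : 'I_M.+1 => Ordinal (hlt i)).
  by move=> i j [] /(pcan_inj (@pickleK _)) [/val_inj].
by have := leq_card _ inj; rewrite !card_ord ltnn.
Qed.

(** Each [n] has at most one first hit, and none from [n0] on. *)
Lemma cuts_finite y n0 : (forall n, (n0 <= n)%N -> ~ (\bigcup_m W n m) y) ->
  exists K, forall k, (K <= k)%N -> ~~ cuts y k.
Proof.
move=> hy.
have /choice[b hb] : forall n, exists b, forall m, first_hit y n m -> (pickle (n, m) <= b)%N.
  move=> n; have [[m [h1 h2]]|h] := pselect (exists m, first_hit y n m); last first.
    by exists 0%N => m hm; case: h; exists m.
  exists (pickle (n, m)) => m' [h1' h2']; suff -> : m' = m by [].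
  by case: (ltngtP m' m) => // [/h2|/h2'].
exists (\max_(n < n0) b n).+1 => k Kk; apply/negP; rewrite /cuts.
case E : (pickle_inv k) => [[n m]|//] /asboolP /= hit.
have kE : pickle (n, m) = k.
  by have := @pickle_invK (nat * nat)%type k; rewrite E.
have [nn0|] := ltnP n n0; last by move=> /hy; apply; exists m => //; case: hit.
have := hb _ _ hit; rewrite kE leqNgt => /negP; apply.
apply: leq_ltn_trans Kk; exact: (leq_bigmax (Ordinal nn0)).
Qed.

End Cuts.

Lemma D2Phat_blocknorm (a : nat -> bool) :
  (forall m, exists2 k, (m <= k)%N & a k) -> D2Phat (blocknorm a).
Proof.
move=> ha; split=> [|X T muT]; first exact: Bset_blocknorm.
apply: (d2cond_D2P (Pset_blocknorm a) muT); exact: d2cond_blocknorm.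
Qed.

Lemma not_D2Phat_blocknorm (a : nat -> bool) K :
  (forall k, (K <= k)%N -> ~~ a k) -> ~ D2Phat (blocknorm a).
Proof.
move=> /not_d2cond_blocknorm[x [n hx]] [_ hD].
have muP := Pset_blocknorm a; have [X [T muT]] := completion_exists muP.
exact: hx (D2P_d2cond muP muT x n (hD X T muT)).
Qed.

Theorem theorem4p2 : Gdelta_complete_in Bset D2Phat.
Proof.
split; first exact: Gdelta_D2Phat.
move=> Y Ypol Yzero B [_ [U [oU ->]]].
(* The sets are made decreasing, so that a point outside [U n] lies outside [V m] for all [m >= n]
   and has only finitely many cuts. *)
pose V n := \bigcap_(i in `I_n.+1) U i.
have oV n : open (V n).
  rewrite /V; elim: n => [|n IH]; first by rewrite bigcap_mkord big_ord1.
  by rewrite bigcap_mkord big_ord_recr -bigcap_mkord; apply: openI.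
have /choice[W hW] := fun n => open_bigcup_clopen Ypol Yzero (oV n).
have Wcl n m : clopen (W n m) by have [] := hW n.
have WV n : V n = \bigcup_m W n m by have [] := hW n.
exists (fun y => blocknorm (cuts W y)); split; [|split].
- by apply: blocknorm_cut_continuous => k y; exact: cuts_near.
- by move=> y; exact: Bset_blocknorm.
apply/seteqP; split=> y; rewrite setTI.
  move=> hy; apply: D2Phat_blocknorm; apply: cuts_infinite => n.
  by rewrite -WV => i _; exact: hy.
move=> hD n _; apply: contrapT => nUy.
have [k Vk] : exists K, forall k, (K <= k)%N -> ~~ cuts W y k.
  apply: (@cuts_finite _ _ _ n) => m nm; rewrite -WV => /(_ n); apply: contra_not nUy.
  by apply; rewrite /= ltnS.
exact: not_D2Phat_blocknorm Vk hD.
Qed.
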